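(* In the binary model, let $0<\tau<1/24$ be a constant and let $\boldsymbol\theta^*=\boldsymbol\theta^*_n\in\mathbb{R}^{2n-1}$ satisfy $\|\boldsymbol\theta^*\|_\infty\le\tau\log n$, and let $A\sim\mathbb{P}_{\boldsymbol\theta^*}$. Then as $n\to\infty$, with probability tending to one the MLE $\hat{\boldsymbol\theta}$ exists and satisfies \[ \|\hat{\boldsymbol\theta}-\boldsymbol\theta^*\|_\infty=O_p\Bigl(\frac{(\log n)^{1/2}e^{8\|\boldsymbol\theta^*\|_\infty}}{n^{1/2}}\Bigr)=o_p(1). \] Moreover, whenever the MLE exists it is unique.
   Context: Binary model: Let $n\ge2$. For $\boldsymbol\theta=(\alpha_1,\dots,\alpha_n,\beta_1,\dots,\beta_{n-1})^\top\in\mathbb{R}^{2n-1}$ set $\beta_n=0$, and let $\mathbb{P}_{\boldsymbol\theta}$ be the law of a random $n\times n$ matrix $A=(a_{i,j})$ with $a_{i,i}=0$ and $a_{i,j}$ ($i\ne j$) mutually independent Bernoulli with $\mathbb{P}(a_{i,j}=1)=e^{\alpha_i+\beta_j}/(1+e^{\alpha_i+\beta_j})$. Out-degrees $d_i=\sum_{j\ne i}a_{i,j}$, in-degrees $b_j=\sum_{i\ne j}a_{i,j}$. The MLE $\hat{\boldsymbol\theta}=(\hat\alpha_1,\dots,\hat\alpha_n,\hat\beta_1,\dots,\hat\beta_{n-1})^\top$ (with $\hat\beta_n=0$) is a solution in $\mathbb{R}^{2n-1}$ of the likelihood equations $d_i=\sum_{k\ne i}\frac{e^{\hat\alpha_i+\hat\beta_k}}{1+e^{\hat\alpha_i+\hat\beta_k}}$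 ($i=1,\dots,n$) and $b_j=\sum_{k\ne j}\frac{e^{\hat\alpha_k+\hat\beta_j}}{1+e^{\hat\alpha_k+\hat\beta_j}}$ ($j=1,\dots,n-1$). *)

(* Defs.v *)
From Stdlib Require Import Reals List Arith ClassicalEpsilon.
Import ListNotations.
Open Scope R_scope.

(* Conventions: indices are 0-based. A parameter theta in R^{2n-1} is a pair
   (alpha, beta) of functions nat -> R, of which only alpha i (i < n) and
   beta j (j < n-1) are meaningful; beta_{n-1} := 0 (paper's beta_n = 0). *)

Fixpoint sumR (n : nat) (f : nat -> R) : R :=
  match n with O => 0 | S m => sumR m f + f m end.

Fixpoint prodR (n : nat) (f : nat -> R) : R :=
  match n with O => 1 | S m => prodR m f * f m end.

Definition maxR (n : nat) (f : nat -> R) : R :=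
  fold_right Rmax 0 (map f (seq 0 n)).

Definition supnorm (n : nat) (alpha beta : nat -> R) : R :=
  Rmax (maxR n (fun i => Rabs (alpha i))) (maxR (n - 1) (fun j => Rabs (beta j))).

Definition betaN (n : nat) (beta : nat -> R) (j : nat) : R :=
  if Nat.eqb j (n - 1) then 0 else beta j.

Definition logistic (x : R) : R := exp x / (1 + exp x).

(* A random n x n 0/1 matrix is encoded row-major as a list of n*n booleans. *)
Definition entry (n : nat) (A : list bool) (i j : nat) : bool := nth (i * n + j) A false.

Definition b2R (b : bool) : R := if b then 1 else 0.

Definition sum_off (n i : nat) (f : nat -> R) : R :=
  sumR n (fun k => if Nat.eqb k i then 0 else f k).

Definition outdeg (n : nat) (A : list bool) (i : nat) : R :=
  sum_off n i (fun k => b2R (entry n A i k)).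

Definition indeg (n : nat) (A : list bool) (j : nat) : R :=
  sum_off n j (fun k => b2R (entry n A k j)).

(* (alpha, beta) solves the likelihood equations for the observation A *)
Definition is_MLE (n : nat) (A : list bool) (alpha beta : nat -> R) : Prop :=
  (forall i, (i < n)%nat ->
     outdeg n A i = sum_off n i (fun k => logistic (alpha i + betaN n beta k))) /\
  (forall j, (j < n - 1)%nat ->
     indeg n A j = sum_off n j (fun k => logistic (alpha k + betaN n beta j))).

Definition MLE_exists (n : nat) (A : list bool) : Prop :=
  exists alpha beta, is_MLE n A alpha beta.

Fixpoint all_bools (k : nat) : list (list bool) :=
  match k with
  | O => [nil]
  | S m => flat_map (fun l => [true :: l; false :: l]) (all_bools m)
  end.

Definition mass (n : nat) (alpha beta : nat -> R) (A : list bool) : R :=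
  prodR n (fun i => prodR n (fun j =>
    if Nat.eqb i j then (if entry n A i j then 0 else 1)
    else let p := logistic (alpha i + betaN n beta j) in
         if entry n A i j then p else 1 - p)).

Definition prob (n : nat) (alpha beta : nat -> R) (E : list bool -> Prop) : R :=
  fold_right Rplus 0
    (map (fun A => if excluded_middle_informative (E A) then mass n alpha beta A else 0)
         (all_bools (n * n))).

Definition rate (n : nat) (s : R) : R :=
  sqrt (ln (INR n)) * exp (8 * s) / sqrt (INR n).

(* Main.v *)
Require Import Defs.
From Stdlib Require Import Reals List Arith Lra Lia ClassicalEpsilon.
Open Scope R_scope.

(* Solving the i-th out-degree equation for alpha_i with beta fixed makes alpha
   minus its comparison point a weighted mean of minus the beta-differences, with
   weights comparable up to the factor slope_min = exp(-2(2s+1))/4, where s is the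
   sup norm of the true parameter; the in-degree equations behave in the same way.
   Hence beta -> alpha -> beta contracts the oscillation seminorm, and near the true
   parameter it has a fixed point up to an additive constant.  That constant
   vanishes because the out-degrees and the in-degrees have the same total.  The
   distance to the true parameter is of order R / (n slope_min^2) when all degrees
   deviate from their means by at most R, and Chernoff's bound gives
   R = 4 sqrt(n log n) outside an event of probability 4/n. *)

(** The equations see only the sums alpha_i + beta_k, so (alpha + c, beta - c) solves whatever
    (alpha, beta) solves. No norm that detects constants can contract, which is why a seminorm blind
    to them is used. The obstacle is that the weights are bounded below only while all sums stay in
    [-B, B]. At the true parameter they are at most 2s; taking B = 2s + 1 leaves room 1, and every
    iterate has to be kept within that room. Hence existence and the error bound come out of one
    argument, the fixed point being built inside a small ball. The two factors of slope_min have
    different origins: one converts a degree deviation into the error delta of a single half step,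
    the other sums these errors under a contraction whose gap is proportional to slope_min. Since
    slope_min(2s+1)^(-2) = 16 exp(8s+4), this is the source of exp(8s); with tau < 1/24 it stays
    below n^(1/3), and the error is n^(-1/6) up to logarithms. *)

Lemma Rabs_le_inv a b : Rabs a <= b -> - b <= a <= b.
Proof. unfold Rabs; destruct (Rcase_abs a); lra. Qed.

(** * Finite sums and off-diagonal sums *)

Lemma sumR_ext n f g : (forall i, (i < n)%nat -> f i = g i) -> sumR n f = sumR n g.
Proof. induction n; simpl; intros H; auto. rewrite IHn, (H n); auto. Qed.

Lemma sumR_le n f g : (forall i, (i < n)%nat -> f i <= g i) -> sumR n f <= sumR n g.
Proof.
  induction n; simpl; intros H; [lra|].
  apply Rplus_le_compat; auto.
Qed.

Lemma sumR_plus n f g : sumR n (fun i => f i + g i) = sumR n f + sumR n g.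
Proof. induction n; simpl; lra. Qed.

Lemma sumR_scal n c f : sumR n (fun i => c * f i) = c * sumR n f.
Proof. induction n; simpl; lra. Qed.

Lemma sumR_const n c : sumR n (fun _ => c) = INR n * c.
Proof. induction n; [simpl; lra|]. rewrite S_INR; simpl; lra. Qed.

Lemma sumR_swap n m f :
  sumR n (fun i => sumR m (fun j => f i j)) = sumR m (fun j => sumR n (fun i => f i j)).
Proof.
  induction n; simpl; [rewrite sumR_const; ring|].
  rewrite IHn, <- sumR_plus; reflexivity.
Qed.

Lemma sumR_nonneg n f : (forall i, (i < n)%nat -> 0 <= f i) -> 0 <= sumR n f.
Proof.
  intros H. replace 0 with (sumR n (fun _ => 0)) by (rewrite sumR_const; ring).
  now apply sumR_le.
Qed.

Lemma sumR_eq0 n f : (forall i, (i < n)%nat -> 0 <= f i) -> sumR n f = 0 ->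
  forall i, (i < n)%nat -> f i = 0.
Proof.
  induction n; simpl; intros H E i Hi; [lia|].
  assert (0 <= sumR n f) by (apply sumR_nonneg; auto).
  assert (0 <= f n) by auto.
  destruct (Nat.eq_dec i n) as [->|Hne]; [lra|].
  apply IHn; auto; [lra|lia].
Qed.

Lemma sumR_single n i f : (i < n)%nat -> sumR n (fun k => if Nat.eqb k i then f k else 0) = f i.
Proof.
  induction n; intros Hi; [lia|]. simpl.
  destruct (Nat.eqb_spec n i) as [->|Hne].
  - rewrite (sumR_ext i _ (fun _ => 0)); [rewrite sumR_const; lra|].
    intros k Hk; destruct (Nat.eqb_spec k i); [lia|reflexivity].
  - rewrite IHn; [lra|lia].
Qed.

Lemma sum_off_eq n i f : (i < n)%nat -> sum_off n i f = sumR n f - f i.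
Proof.
  intros Hi. rewrite <- (sumR_single n i f Hi). unfold sum_off.
  assert (H : sumR n f = sumR n (fun k => if Nat.eqb k i then 0 else f k)
                       + sumR n (fun k => if Nat.eqb k i then f k else 0)).
  { rewrite <- sumR_plus. apply sumR_ext; intros k _; destruct (Nat.eqb k i); ring. }
  lra.
Qed.

Lemma sum_off_ext n i f g :
  (forall k, (k < n)%nat -> k <> i -> f k = g k) -> sum_off n i f = sum_off n i g.
Proof.
  intros H; apply sumR_ext; intros k Hk; destruct (Nat.eqb_spec k i); auto.
Qed.

Lemma sum_off_le n i f g :
  (forall k, (k < n)%nat -> k <> i -> f k <= g k) -> sum_off n i f <= sum_off n i g.
Proof.
  intros H; apply sumR_le; intros k Hk; destruct (Nat.eqb_spec k i); auto; lra.
Qed.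

Lemma sum_off_plus n i f g : sum_off n i (fun k => f k + g k) = sum_off n i f + sum_off n i g.
Proof.
  unfold sum_off; rewrite <- sumR_plus.
  apply sumR_ext; intros k _; destruct (Nat.eqb k i); ring.
Qed.

Lemma sum_off_scal n i c f : sum_off n i (fun k => c * f k) = c * sum_off n i f.
Proof.
  unfold sum_off; rewrite <- sumR_scal.
  apply sumR_ext; intros k _; destruct (Nat.eqb k i); ring.
Qed.

Lemma sum_off_minus n i f g : sum_off n i (fun k => f k - g k) = sum_off n i f - sum_off n i g.
Proof.
  rewrite (sum_off_ext n i (fun k => f k - g k) (fun k => f k + (-1) * g k)) by (intros; ring).
  rewrite sum_off_plus, sum_off_scal; ring.
Qed.

Lemma sum_off_const n i c : (i < n)%nat -> sum_off n i (fun _ => c) = (INR n - 1) * c.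
Proof. intros Hi; rewrite sum_off_eq, sumR_const by exact Hi; ring. Qed.

Lemma sum_off_swap n f :
  sumR n (fun i => sum_off n i (fun j => f i j)) = sumR n (fun j => sum_off n j (fun i => f i j)).
Proof.
  unfold sum_off; rewrite sumR_swap.
  apply sumR_ext; intros j _; apply sumR_ext; intros i _; now rewrite Nat.eqb_sym.
Qed.

(** * The logistic function and its difference quotients *)

Lemma logistic_01 x : 0 < logistic x < 1.
Proof.
  unfold logistic. pose proof (exp_pos x).
  split; [apply Rdiv_lt_0_compat; lra|].
  apply Rmult_lt_reg_r with (1 + exp x); [lra|].
  unfold Rdiv; rewrite Rmult_assoc, Rinv_l; lra.
Qed.

Lemma logistic_sub x y :
  logistic x - logistic y = (exp x - exp y) / ((1 + exp x) * (1 + exp y)).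
Proof.
  unfold logistic. pose proof (exp_pos x). pose proof (exp_pos y). field; lra.
Qed.

Lemma logistic_incr x y : x < y -> logistic x < logistic y.
Proof.
  intros H. apply Rlt_0_minus. rewrite logistic_sub.
  pose proof (exp_pos x). pose proof (exp_pos y). pose proof (exp_increasing _ _ H).
  apply Rdiv_lt_0_compat; [lra|apply Rmult_lt_0_compat; lra].
Qed.

Lemma logistic_le x y : x <= y -> logistic x <= logistic y.
Proof. intros [H| ->]; [left; now apply logistic_incr|lra]. Qed.

Lemma logistic_continuity : continuity logistic.
Proof.
  intros x. apply continuity_pt_div.
  - apply derivable_continuous_pt, derivable_pt_exp.
  - apply continuity_pt_plus; [apply continuity_pt_const; now intros ? ?|].
    apply derivable_continuous_pt, derivable_pt_exp.
  - pose proof (exp_pos x); lra.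
Qed.

(** A lower bound for the derivative of [logistic] on [-B, B], whose true minimum is of order
    exp(-B). *)
Definition slope_min (B : R) : R := exp (- (2 * B)) / 4.

Lemma slope_min_01 B : 0 <= B -> 0 < slope_min B <= 1.
Proof.
  intros HB; unfold slope_min. pose proof (exp_pos (- (2 * B))).
  assert (exp (- (2 * B)) <= 1).
  { rewrite <- exp_0. destruct HB as [HB| <-].
    - left; apply exp_increasing; lra.
    - right; f_equal; ring. }
  lra.
Qed.

Lemma exp_le x y : x <= y -> exp x <= exp y.
Proof. intros [H| ->]; [left; now apply exp_increasing|lra]. Qed.

(** Convexity of exp puts e^x - e^y between e^y (x - y) and e^x (x - y). The denominator (1 + e^x)(1
    + e^y) is at most 4 e^(2B) e^y and at least e^x. *)
Lemma logistic_diff_bounds B x y : 0 <= B -> Rabs x <= B -> Rabs y <= B -> y <= x ->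
  slope_min B * (x - y) <= logistic x - logistic y <= x - y.
Proof.
  intros HB Hx Hy Hyx. apply Rabs_le_inv in Hx, Hy. rewrite logistic_sub.
  assert (P : 0 < exp y) by apply exp_pos. assert (Q : 0 < exp x) by apply exp_pos.
  assert (Z : 0 < exp B) by apply exp_pos.
  assert (E1 : exp y * (x - y) <= exp x - exp y).
  { pose proof (exp_ineq1_le (x - y)) as H.
    replace (exp x) with (exp y * exp (x - y)) by (rewrite <- exp_plus; f_equal; ring). nra. }
  assert (E2 : exp x - exp y <= exp x * (x - y)).
  { pose proof (exp_ineq1_le (y - x)) as H.
    replace (exp y) with (exp x * exp (y - x)) by (rewrite <- exp_plus; f_equal; ring). nra. }
  assert (D : 0 < (1 + exp x) * (1 + exp y)) by nra.
  assert (W : (1 + exp x) * (1 + exp y) * ((exp x - exp y) / ((1 + exp x) * (1 + exp y)))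
              = exp x - exp y) by (field; lra).
  set (q := _ / _) in *. clearbody q. split.
  - apply Rmult_le_reg_l with (1 := D). rewrite W.
    apply Rle_trans with (2 := E1). rewrite <- Rmult_assoc.
    apply Rmult_le_compat_r; [lra|].
    unfold slope_min.
    replace (exp (- (2 * B))) with (/ exp B * / exp B)
      by (rewrite <- exp_Ropp, <- exp_plus; f_equal; ring).
    assert (H1 : 1 + exp x <= 2 * exp B).
    { pose proof (exp_le x B ltac:(lra)). pose proof (exp_le 0 B HB). rewrite exp_0 in *. lra. }
    assert (H2 : 1 + exp y <= 2 * exp B * exp y).
    { pose proof (exp_le 0 (B + y) ltac:(lra)). pose proof (exp_le 0 B HB).
      rewrite exp_plus, exp_0 in *. nra. }
    assert (H3 : (1 + exp x) * (1 + exp y) <= 2 * exp B * (2 * exp B * exp y))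
      by (apply Rmult_le_compat; lra).
    apply Rmult_le_compat_r with (r := / exp B * / exp B / 4) in H3.
    + replace (2 * exp B * (2 * exp B * exp y) * (/ exp B * / exp B / 4)) with (exp y) in H3
        by (field; lra). exact H3.
    + pose proof (Rinv_0_lt_compat _ Z). nra.
  - apply Rmult_le_reg_l with (1 := D). rewrite W. nra.
Qed.

(** On the diagonal [slope_eq] allows any value; 1 lies in [slope_min B, 1] for every B >= 0 at
    once. *)
Definition slope (x y : R) : R :=
  if Req_EM_T x y then 1 else (logistic x - logistic y) / (x - y).

Lemma slope_eq x y : logistic x - logistic y = slope x y * (x - y).
Proof. unfold slope; destruct (Req_EM_T x y) as [->|H]; [ring|field; lra]. Qed.

Lemma slope_bounds B x y : 0 <= B -> Rabs x <= B -> Rabs y <= B ->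
  slope_min B <= slope x y <= 1.
Proof.
  intros HB Hx Hy. unfold slope. destruct (Req_EM_T x y) as [_|Hne].
  { pose proof (slope_min_01 B HB); lra. }
  destruct (Rtotal_order x y) as [Hlt|[?|Hgt]]; [|lra|].
  - pose proof (logistic_diff_bounds B y x HB Hy Hx ltac:(lra)) as H.
    replace ((logistic x - logistic y) / (x - y))
      with ((logistic y - logistic x) / (y - x)) by (field; lra).
    split; apply Rmult_le_reg_r with (y - x); try lra;
      unfold Rdiv; rewrite Rmult_assoc, Rinv_l; lra.
  - pose proof (logistic_diff_bounds B x y HB Hx Hy ltac:(lra)) as H.
    split; apply Rmult_le_reg_r with (x - y); try lra;
      unfold Rdiv; rewrite Rmult_assoc, Rinv_l; lra.
Qed.

(** * Oscillation and weighted means *)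

Definition osc_le (n : nat) (x : nat -> R) (r : R) : Prop :=
  forall i j, (i < n)%nat -> (j < n)%nat -> x i - x j <= r.

Lemma exists_max n (x : nat -> R) : (0 < n)%nat ->
  exists i, (i < n)%nat /\ forall k, (k < n)%nat -> x k <= x i.
Proof.
  induction n as [|n IH]; intros H; [lia|].
  destruct n as [|n].
  { exists 0%nat; split; [lia|]. intros k Hk; replace k with 0%nat by lia; lra. }
  destruct IH as [i [Hi Hm]]; [lia|].
  destruct (Rle_dec (x i) (x (S n))) as [Hle|Hgt].
  - exists (S n); split; [lia|]. intros k Hk.
    destruct (Nat.eq_dec k (S n)) as [->|]; [lra|].
    specialize (Hm k ltac:(lia)); lra.
  - exists i; split; [lia|]. intros k Hk.
    destruct (Nat.eq_dec k (S n)) as [->|]; [lra|]. apply Hm; lia.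
Qed.

Lemma osc_le_interval n x r : (0 < n)%nat -> osc_le n x r ->
  exists M, forall k, (k < n)%nat -> M - r <= x k <= M.
Proof.
  intros Hn H. destruct (exists_max n x Hn) as [i [Hi Hm]].
  exists (x i). intros k Hk. specialize (H i k Hi Hk). specialize (Hm k Hk). lra.
Qed.

(** Divide by the total weight V, which lies between m (n-1) and n-1. The error term becomes at most
    delta, while each gap M - D k keeps a share of at least m / (n-1) and pulls the mean below M. *)
Lemma weighted_mean_le n i m delta v x D M :
  (2 <= n)%nat -> (i < n)%nat -> 0 < m -> 0 <= delta ->
  (forall k, (k < n)%nat -> k <> i -> m <= v k <= 1) ->
  (forall k, (k < n)%nat -> D k <= M) ->
  sum_off n i (fun k => v k * (x - D k)) <= m * (INR n - 1) * delta ->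
  x <= M + delta - m * sum_off n i (fun k => M - D k) / (INR n - 1).
Proof.
  intros Hn Hi Hm Hd Hv HD Hs.
  assert (HN : 1 <= INR n - 1). { apply le_INR in Hn. simpl in Hn. lra. }
  assert (E : sum_off n i (fun k => v k * (x - D k))
    = (x - M) * sum_off n i v + sum_off n i (fun k => v k * (M - D k))).
  { rewrite <- sum_off_scal, <- sum_off_plus. apply sum_off_ext; intros; ring. }
  assert (V1 : m * (INR n - 1) <= sum_off n i v).
  { rewrite Rmult_comm, <- (sum_off_const n i m Hi). apply sum_off_le; intros; now apply Hv. }
  assert (V2 : sum_off n i v <= INR n - 1).
  { rewrite <- (Rmult_1_r (INR n - 1)), <- (sum_off_const n i 1 Hi).
    apply sum_off_le; intros; now apply Hv. }
  assert (Q : m * sum_off n i (fun k => M - D k) <= sum_off n i (fun k => v k * (M - D k))).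
  { rewrite <- sum_off_scal. apply sum_off_le; intros k Hk Hki.
    specialize (Hv k Hk Hki). specialize (HD k Hk). nra. }
  assert (S0 : 0 <= sum_off n i (fun k => M - D k)).
  { apply Rle_trans with (sum_off n i (fun _ => 0)).
    - rewrite sum_off_const by exact Hi; lra.
    - apply sum_off_le; intros k Hk _; specialize (HD k Hk); lra. }
  rewrite E in Hs. clear E HD Hv.
  set (V := sum_off n i v) in *. set (S := sum_off n i (fun k => M - D k)) in *.
  set (W := sum_off n i _) in *. clearbody V S W. set (N := INR n - 1) in *. clearbody N.
  apply Rnot_lt_le; intros Hc.
  assert (G : V * (M + delta - m * S / N) < V * x) by (apply Rmult_lt_compat_l; nra).
  assert (T : V * (m * S / N) <= m * S).
  { replace (m * S) with (N * (m * S / N)) at 2 by (field; lra).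
    apply Rmult_le_compat_r; [|lra]. apply Rle_mult_inv_pos; nra. }
  nra.
Qed.

(* Two rows of weights in [m, 1] share mass at least about m, so averaging
   contracts the oscillation (Dobrushin's coefficient). *)
Lemma weighted_mean_osc n m delta v A D y r :
  (3 <= n)%nat -> 0 < m -> 0 <= delta ->
  (forall i k, (i < n)%nat -> (k < n)%nat -> k <> i -> m <= v i k <= 1) ->
  (forall i, (i < n)%nat -> sum_off n i (fun k => v i k * (A i + D k)) = y i) ->
  (forall i, (i < n)%nat -> Rabs (y i) <= m * (INR n - 1) * delta) ->
  osc_le n D r -> osc_le n A ((1 - m / 2) * r + 2 * delta).
Proof.
  intros Hn Hm Hd Hv He Hy Hr i j Hi Hj.
  assert (HN : 3 <= INR n). { apply le_INR in Hn. simpl in Hn. lra. }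
  destruct (osc_le_interval n D r ltac:(lia) Hr) as [M HM].
  assert (U : A i <= - (M - r) + delta
      - m * sum_off n i (fun k => - (M - r) - - D k) / (INR n - 1)).
  { apply weighted_mean_le with (v := v i); auto; try lia.
    - intros k Hk; specialize (HM k Hk); lra.
    - rewrite (sum_off_ext n i _ (fun k => v i k * (A i + D k))) by (intros; ring).
      rewrite He by exact Hi. specialize (Hy i Hi). apply Rabs_le_inv in Hy. lra. }
  assert (L : - A j <= M + delta - m * sum_off n j (fun k => M - D k) / (INR n - 1)).
  { apply weighted_mean_le with (v := v j); auto; try lia.
    - intros k Hk; specialize (HM k Hk); lra.
    - rewrite (sum_off_ext n j _ (fun k => -1 * (v j k * (A j + D k)))) by (intros; ring).
      rewrite sum_off_scal, He by exact Hj. specialize (Hy j Hj). apply Rabs_le_inv in Hy. lra. }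
  (* For each k the two gaps add up to r. Only the diagonal terms k = i of the first sum and k = j
     of the second are missing, each at most r. For n >= 3, n - 2 is at least (n - 1) / 2, which
     yields the m / 2 of the contraction factor. *)
  assert (S : (INR n - 2) * r <= sum_off n i (fun k => - (M - r) - - D k)
                                 + sum_off n j (fun k => M - D k)).
  { rewrite !sum_off_eq by assumption.
    assert (T : sumR n (fun k => - (M - r) - - D k) + sumR n (fun k => M - D k) = INR n * r).
    { rewrite <- sumR_plus, <- sumR_const. apply sumR_ext; intros; ring. }
    pose proof (HM i Hi). pose proof (HM j Hj). lra. }
  set (S1 := sum_off n i _) in *. set (S2 := sum_off n j _) in *. clearbody S1 S2.
  assert (r0 : 0 <= r). { specialize (Hr i i Hi Hi). lra. }
  assert (F : m * r / 2 <= m * S1 / (INR n - 1) + m * S2 / (INR n - 1)).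
  { replace (m * S1 / (INR n - 1) + m * S2 / (INR n - 1)) with (m * (S1 + S2) / (INR n - 1))
      by (field; lra).
    apply Rmult_le_reg_r with (INR n - 1); [lra|].
    unfold Rdiv at 2; rewrite Rmult_assoc, Rinv_l, Rmult_1_r by lra.
    apply Rle_trans with (m * ((INR n - 2) * r)); [|apply Rmult_le_compat_l; lra].
    assert (0 <= m * r) by nra. nra. }
  lra.
Qed.

(** * Half steps: solving the equations of one side *)

Lemma sum_off_continuity n i (f : nat -> R -> R) :
  (forall k, continuity (f k)) -> continuity (fun t => sum_off n i (fun k => f k t)).
Proof.
  intros H. unfold sum_off. induction n as [|n IH]; simpl.
  - apply continuity_const; now intros ? ?.
  - apply continuity_plus with (1 := IH).
    destruct (Nat.eqb n i); [apply continuity_const; now intros ? ?|apply H].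
Qed.

(** Intermediate values between a - M - delta and a - (M - r) + delta, where b' - b ranges over
    [M - r, M]. At these ends every argument is at least delta below, respectively above, a + b k,
    so the sum has moved by at least slope_min B (n-1) delta, enough to pass d. The room r + delta
    keeps the compared arguments in [-B, B]. *)
Lemma scalar_equation_solvable n i a b b' d r delta B :
  (2 <= n)%nat -> (i < n)%nat -> 0 <= B -> 0 <= r -> 0 <= delta ->
  (forall k, (k < n)%nat -> Rabs (a + b k) + r + delta <= B) ->
  osc_le n (fun k => b' k - b k) r ->
  Rabs (d - sum_off n i (fun k => logistic (a + b k))) <= slope_min B * (INR n - 1) * delta ->
  exists t, sum_off n i (fun k => logistic (t + b' k)) = d /\
    forall k, (k < n)%nat -> Rabs ((t + b' k) - (a + b k)) <= r + delta.
Proof.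
  intros Hn Hi HB Hr Hd Hab Ho Hs.
  destruct (osc_le_interval n _ r ltac:(lia) Ho) as [M HM].
  set (f := fun t => sum_off n i (fun k => logistic (t + b' k)) - d).
  apply Rabs_le_inv in Hs.
  assert (Hlo : f (a - M - delta) <= 0).
  { assert (T : slope_min B * (INR n - 1) * delta <=
      sum_off n i (fun k => logistic (a + b k) - logistic (a - M - delta + b' k))).
    { replace (slope_min B * (INR n - 1) * delta) with ((INR n - 1) * (slope_min B * delta)) by ring.
      rewrite <- (sum_off_const n i) by exact Hi. apply sum_off_le; intros k Hk _.
      specialize (Hab k Hk). specialize (HM k Hk). simpl in HM.
      pose proof (Rabs_le_inv (a + b k) _ (Rle_refl _)) as Z.
      pose proof (logistic_le (a - M - delta + b' k) (a + b k - delta) ltac:(lra)).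
      pose proof (logistic_diff_bounds B (a + b k) (a + b k - delta) HB) as W.

      destruct W; try (apply Rabs_le); try lra. }
    rewrite sum_off_minus in T. unfold f. lra. }
  assert (Hhi : 0 <= f (a - (M - r) + delta)).
  { assert (T : slope_min B * (INR n - 1) * delta <=
      sum_off n i (fun k => logistic (a - (M - r) + delta + b' k) - logistic (a + b k))).
    { replace (slope_min B * (INR n - 1) * delta) with ((INR n - 1) * (slope_min B * delta)) by ring.
      rewrite <- (sum_off_const n i) by exact Hi. apply sum_off_le; intros k Hk _.
      specialize (Hab k Hk). specialize (HM k Hk). simpl in HM.
      pose proof (Rabs_le_inv (a + b k) _ (Rle_refl _)) as Z.
      pose proof (logistic_le (a + b k + delta) (a - (M - r) + delta + b' k) ltac:(lra)).
      pose proof (logistic_diff_bounds B (a + b k + delta) (a + b k) HB) as W.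

      destruct W; try (apply Rabs_le); try lra. }
    rewrite sum_off_minus in T. unfold f. lra. }
  destruct (IVT_cor f (a - M - delta) (a - (M - r) + delta)) as [t [Ht Hf]].
  - apply continuity_minus; [|apply continuity_const; now intros ? ?].
    apply (sum_off_continuity n i (fun k t => logistic (t + b' k))).
    intros k. apply (continuity_comp (fun t => t + b' k) logistic).
    + apply continuity_plus; [apply derivable_continuous, derivable_id|].
      apply continuity_const; now intros ? ?.
    + apply logistic_continuity.
  - lra.
  - nra.
  - exists t. split; [unfold f in Hf; lra|].
    intros k Hk. specialize (HM k Hk). simpl in HM. apply Rabs_le; lra.
Qed.

(** The sequence [b] is given and [a] is sought. The distance to the comparison point travels with
    the equation, since it is what keeps later slopes above [slope_min]. *)
Definition half_solution (n : nat) (d a0 b0 : nat -> R) (e : R) (b a : nat -> R) : Prop :=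
  forall i, (i < n)%nat ->
    sum_off n i (fun k => logistic (a i + b k)) = d i /\
    forall k, (k < n)%nat -> Rabs ((a i + b k) - (a0 i + b0 k)) <= e.

Lemma half_solution_exists n d a0 b0 b r delta B :
  (2 <= n)%nat -> 0 <= B -> 0 <= r -> 0 <= delta ->
  (forall i k, (i < n)%nat -> (k < n)%nat -> Rabs (a0 i + b0 k) + r + delta <= B) ->
  osc_le n (fun k => b k - b0 k) r ->
  (forall i, (i < n)%nat -> Rabs (d i - sum_off n i (fun k => logistic (a0 i + b0 k)))
      <= slope_min B * (INR n - 1) * delta) ->
  exists a, half_solution n d a0 b0 (r + delta) b a.
Proof.
  intros Hn HB Hr Hd Hab Ho Hs.
  set (P := fun i t => sum_off n i (fun k => logistic (t + b k)) = d i /\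
    forall k, (k < n)%nat -> Rabs ((t + b k) - (a0 i + b0 k)) <= r + delta).
  exists (fun i => epsilon (inhabits 0) (P i)). intros i Hi.
  apply (epsilon_spec (inhabits 0) (P i)).
  apply scalar_equation_solvable with (B := B); auto.
Qed.

(** By [slope_eq] the difference of two systems is exactly linear in the parameter differences, with
    difference quotients as weights. The discrepancy delta is 0 between two iterates and positive
    against the comparison point. *)
Lemma half_step_osc n a b a' b' r delta B :
  (3 <= n)%nat -> 0 <= B -> 0 <= delta ->
  (forall i k, (i < n)%nat -> (k < n)%nat -> Rabs (a i + b k) <= B) ->
  (forall i k, (i < n)%nat -> (k < n)%nat -> Rabs (a' i + b' k) <= B) ->
  (forall i, (i < n)%nat ->
     Rabs (sum_off n i (fun k => logistic (a i + b k)) - sum_off n i (fun k => logistic (a' i + b' k)))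
       <= slope_min B * (INR n - 1) * delta) ->
  osc_le n (fun k => b k - b' k) r ->
  osc_le n (fun i => a i - a' i) ((1 - slope_min B / 2) * r + 2 * delta).
Proof.
  intros Hn HB Hd H H' He Ho.
  apply (weighted_mean_osc n (slope_min B) delta (fun i k => slope (a i + b k) (a' i + b' k))
    (fun i => a i - a' i) (fun k => b k - b' k)
    (fun i => sum_off n i (fun k => logistic (a i + b k)) - sum_off n i (fun k => logistic (a' i + b' k)))
    r Hn); auto.
  - now apply slope_min_01.
  - intros i k Hi Hk _. apply slope_bounds; auto.
  - intros i Hi. rewrite <- sum_off_minus. apply sum_off_ext; intros k Hk _.
    rewrite slope_eq; ring.
Qed.

(** * Geometric convergence and the fixed point theorem *)

Lemma pow_le_eventually q c eps : 0 <= q < 1 -> 0 <= c -> 0 < eps ->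
  exists T, forall t, (T <= t)%nat -> c * q ^ t < eps.
Proof.
  intros Hq Hc He.
  destruct (pow_lt_1_zero q ltac:(rewrite Rabs_pos_eq; lra) (eps / (c + 1))) as [T HT].
  { apply Rdiv_lt_0_compat; lra. }
  exists T. intros t Ht. specialize (HT t Ht). pose proof (pow_le q t (proj1 Hq)) as P.
  rewrite Rabs_pos_eq in HT by exact P.
  apply Rle_lt_trans with ((c + 1) * q ^ t); [nra|].
  replace eps with ((c + 1) * (eps / (c + 1))) by (field; lra).
  apply Rmult_lt_compat_l; lra.
Qed.

Lemma geometric_steps (x : nat -> R) c q : 0 <= q < 1 ->
  (forall t, Rabs (x (S t) - x t) <= c * q ^ t) ->
  forall t k, Rabs (x (t + k)%nat - x t) <= c / (1 - q) * q ^ t.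
Proof.
  intros Hq H t k.
  assert (c0 : 0 <= c). { pose proof (Rabs_pos (x 1%nat - x 0%nat)). specialize (H 0%nat). simpl in H. lra. }
  (* Keeping the exact partial geometric sum makes the induction on k close. *)
  assert (G : Rabs (x (t + k)%nat - x t) <= c / (1 - q) * (q ^ t - q ^ (t + k))).
  { induction k as [|k IH].
    - rewrite Nat.add_0_r, Rminus_diag, Rabs_R0. lra.
    - rewrite Nat.add_succ_r. simpl pow.
      replace (x (S (t + k)) - x t) with ((x (S (t + k)) - x (t + k)%nat) + (x (t + k)%nat - x t)) by ring.
      eapply Rle_trans; [apply Rabs_triang|].
      eapply Rle_trans; [apply Rplus_le_compat; [apply H|apply IH]|].
      right; field; lra. }
  eapply Rle_trans; [apply G|]. apply Rmult_le_compat_l.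
  - apply Rle_mult_inv_pos; lra.
  - pose proof (pow_le q (t + k) (proj1 Hq)). lra.
Qed.

Lemma geometric_limit (x : nat -> R) c q : 0 <= q < 1 ->
  (forall t, Rabs (x (S t) - x t) <= c * q ^ t) ->
  exists l, forall t, Rabs (x t - l) <= c / (1 - q) * q ^ t.
Proof.
  intros Hq H. pose proof (geometric_steps x c q Hq H) as G.
  assert (c0 : 0 <= c / (1 - q)).
  { pose proof (Rabs_pos (x 0%nat - x 0%nat)). specialize (G 0%nat 0%nat). simpl in G. lra. }
  destruct (R_complete x) as [l Hl].
  { intros eps He.
    destruct (pow_le_eventually q (2 * (c / (1 - q))) eps Hq ltac:(lra) He) as [T HT].
    exists T. intros u v Hu Hv. unfold Rdist.
    replace u with (T + (u - T))%nat by lia. replace v with (T + (v - T))%nat by lia.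
    specialize (HT T (le_n _)).
    pose proof (Rabs_le_inv _ _ (G T (u - T)%nat)). pose proof (Rabs_le_inv _ _ (G T (v - T)%nat)).
    apply Rabs_def1; lra. }
  exists l. intros t. apply Rnot_lt_le; intros Hc.
  destruct (Hl (Rabs (x t - l) - c / (1 - q) * q ^ t) ltac:(lra)) as [T HT].
  specialize (HT (t + T)%nat ltac:(lia)). unfold Rdist in HT.
  specialize (G t T).
  pose proof (Rabs_triang (x t - x (t + T)%nat) (x (t + T)%nat - l)) as U.
  replace (x t - x (t + T)%nat + (x (t + T)%nat - l)) with (x t - l) in U by ring.
  rewrite Rabs_minus_sym in G. lra.
Qed.

Lemma le_of_geometric x q c : 0 <= q < 1 -> (forall t, x <= c * q ^ t) -> x <= 0.
Proof.
  intros Hq H. apply Rnot_lt_le; intros Hx.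
  destruct (pow_le_eventually q (Rabs c) x Hq (Rabs_pos c) Hx) as [T HT].
  specialize (HT T (le_n _)). specialize (H T).
  pose proof (pow_le q T (proj1 Hq)). pose proof (Rle_abs c). nra.
Qed.

(* Banach's theorem for the oscillation seminorm, a norm once the last
   coordinate is normalized to 0. *)
Lemma osc_contraction_fixed_point n (S : (nat -> R) -> nat -> R) (x0 : nat -> R) q rho :
  (0 < n)%nat -> 0 <= q < 1 -> 0 <= rho -> x0 (n - 1)%nat = 0 ->
  (forall x, osc_le n (fun i => x i - x0 i) rho -> S x (n - 1)%nat = 0) ->
  (forall x, osc_le n (fun i => x i - x0 i) rho -> osc_le n (fun i => S x i - x0 i) rho) ->
  (forall x y r, osc_le n (fun i => x i - x0 i) rho -> osc_le n (fun i => y i - x0 i) rho ->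
     osc_le n (fun i => x i - y i) r -> osc_le n (fun i => S x i - S y i) (q * r)) ->
  exists x, x (n - 1)%nat = 0 /\ osc_le n (fun i => x i - x0 i) rho /\
    forall i, (i < n)%nat -> S x i = x i.
Proof.
  intros Hn Hq Hrho Hx0 HS0 HSb HSc.
  set (x := fun t => Nat.iter t S x0).
  assert (B : forall t, osc_le n (fun i => x t i - x0 i) rho).
  { induction t; [intros i j _ _; simpl; lra|]. now apply HSb. }
  assert (Z : forall t, x t (n - 1)%nat = 0).
  { destruct t; [exact Hx0|]. apply HS0, B. }
  assert (C : forall t, osc_le n (fun i => x t i - x (Datatypes.S t) i) (rho * q ^ t)).
  { induction t as [|t IH].
    - intros i j Hi Hj. pose proof (B 1%nat j i Hj Hi). simpl in *. lra.
    - replace (rho * q ^ Datatypes.S t) with (q * (rho * q ^ t)) by (simpl; ring).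
      apply (HSc (x t) (x (Datatypes.S t))); auto. }
  assert (L : forall i, exists l, (i < n)%nat -> forall t, Rabs (x t i - l) <= rho / (1 - q) * q ^ t).
  { intros i. destruct (lt_dec i n) as [Hi|Hi]; [|exists 0; intros; lia].
    destruct (geometric_limit (fun t => x t i) rho q Hq) as [l Hl]; [|now exists l].
    (* Both iterates vanish at index n-1, so comparing i with n-1 turns the oscillation bound into
       an absolute one. *)
    intros t. pose proof (C t i (n - 1)%nat Hi ltac:(lia)) as U.
    pose proof (C t (n - 1)%nat i ltac:(lia) Hi) as V. simpl in U, V.
    pose proof (Z t) as Zt. pose proof (Z (Datatypes.S t)) as Zs. simpl in Zs.
    rewrite Zt, Zs in U, V. apply Rabs_le. simpl. lra. }
  set (c := rho / (1 - q)) in *.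
  set (l := fun i => epsilon (inhabits 0) (fun l => forall t, Rabs (x t i - l) <= c * q ^ t)).
  assert (Hl : forall i t, (i < n)%nat -> Rabs (x t i - l i) <= c * q ^ t).
  { intros i t Hi. revert t.
    apply (epsilon_spec (inhabits 0) (fun l => forall t, Rabs (x t i - l) <= c * q ^ t)).
    destruct (L i) as [l0 Hl0]. exists l0; auto. }
  assert (Zl : l (n - 1)%nat = 0).
  { assert (E : Rabs (l (n - 1)%nat) <= 0).
    { apply le_of_geometric with (q := q) (c := c); auto. intros t.
      specialize (Hl (n - 1)%nat t ltac:(lia)). rewrite Z in Hl.
      now rewrite Rminus_0_l, Rabs_Ropp in Hl. }
    apply Rabs_le_inv in E; lra. }
  assert (Bl : osc_le n (fun i => l i - x0 i) rho).
  { intros i j Hi Hj. apply Rminus_le.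
    apply le_of_geometric with (q := q) (c := 2 * c); auto. intros t.
    pose proof (Rabs_le_inv _ _ (Hl i t Hi)). pose proof (Rabs_le_inv _ _ (Hl j t Hj)).
    pose proof (B t i j Hi Hj) as W. simpl in W. lra. }
  exists l. split; [exact Zl|]. split; [exact Bl|]. intros i Hi.
  assert (E : Rabs (S l i - l i) <= 0); [|apply Rabs_le_inv in E; lra].
  (* [S l] is within q (2 c q^t) of iterate t+1 by contraction, and that iterate is within c q^(t+1)
     of [l]. *)
  apply le_of_geometric with (q := q) (c := q * (2 * c) + c * q); auto. intros t.
  assert (D : osc_le n (fun k => x t k - l k) (2 * (c * q ^ t))).
  { intros k j Hk Hj. pose proof (Rabs_le_inv _ _ (Hl k t Hk)).
    pose proof (Rabs_le_inv _ _ (Hl j t Hj)). lra. }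
  apply (HSc (x t) l _ (B t) Bl) in D.
  pose proof (D i (n - 1)%nat Hi ltac:(lia)) as U.
  pose proof (D (n - 1)%nat i ltac:(lia) Hi) as V. simpl in U, V.
  pose proof (Z (Datatypes.S t)) as Zs. simpl in Zs. rewrite Zs, (HS0 l Bl) in U, V.
  pose proof (Rabs_le_inv _ _ (Hl i (Datatypes.S t) Hi)) as W. simpl in W.
  apply Rabs_le. lra.
Qed.

(** * Solvability of the likelihood system near a comparison point *)

Lemma sum_off_nonneg n i f : (forall k, (k < n)%nat -> k <> i -> 0 <= f k) -> 0 <= sum_off n i f.
Proof.
  intros H; apply sumR_nonneg; intros k Hk; destruct (Nat.eqb_spec k i); auto; lra.
Qed.

Lemma double_sum_off_eq0 n f :
  (forall i k, (i < n)%nat -> (k < n)%nat -> k <> i -> 0 <= f i k) ->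
  sumR n (fun i => sum_off n i (fun k => f i k)) = 0 ->
  forall i k, (i < n)%nat -> (k < n)%nat -> k <> i -> f i k = 0.
Proof.
  intros H E i k Hi Hk Hki.
  pose proof (fun P => sumR_eq0 n _ P E i Hi) as E1; cbv beta in E1.
  unfold sum_off in E1.
  pose proof (fun Q => sumR_eq0 n (fun k => if Nat.eqb k i then 0 else f i k) Q) as E2.
  cbv beta in E2.
  rewrite <- (E2 (fun k Hk => ltac:(destruct (Nat.eqb_spec k i); [lra|auto]))
    (E1 (fun i' Hi' => sum_off_nonneg n i' _ (fun k Hk Hne => H i' k Hi' Hk Hne))) k Hk).
  destruct (Nat.eqb_spec k i); [contradiction|reflexivity].
Qed.

(** A nonzero common shift moves all terms strictly in the same direction, and the entry (0, 1) is
    off the diagonal. This is what removes the leftover additive constant of the fixed point. *)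
Lemma logistic_shift_eq0 n (x : nat -> nat -> R) c : (2 <= n)%nat ->
  sumR n (fun i => sum_off n i (fun k => logistic (x i k + c)))
    = sumR n (fun i => sum_off n i (fun k => logistic (x i k))) -> c = 0.
Proof.
  intros Hn E.
  assert (D : sumR n (fun i => sum_off n i (fun k => logistic (x i k + c) - logistic (x i k))) = 0).
  { rewrite (sumR_ext n _ (fun i => sum_off n i (fun k => logistic (x i k + c))
      + -1 * sum_off n i (fun k => logistic (x i k)))).
    - rewrite sumR_plus, sumR_scal; lra.
    - intros i _. rewrite sum_off_minus; ring. }
  destruct (Rtotal_order c 0) as [Hc|[Hc|Hc]]; [|exact Hc|].
  - pose proof (logistic_incr (x 0%nat 1%nat + c) (x 0%nat 1%nat) ltac:(lra)).
    assert (D' : sumR n (fun i => sum_off n i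
      (fun k => -1 * (logistic (x i k + c) - logistic (x i k)))) = 0).
    { rewrite (sumR_ext n _ (fun i => -1 * sum_off n i
        (fun k => logistic (x i k + c) - logistic (x i k)))).
      - rewrite sumR_scal, D; ring.
      - intros i _. now rewrite sum_off_scal. }
    pose proof (fun P => double_sum_off_eq0 n _ P D' 0%nat 1%nat ltac:(lia) ltac:(lia) ltac:(lia)) as Z.
    cbv beta in Z. assert (Y : forall i k, (i < n)%nat -> (k < n)%nat -> k <> i ->
       0 <= -1 * (logistic (x i k + c) - logistic (x i k))).
    { intros i k _ _ _. pose proof (logistic_le (x i k + c) (x i k) ltac:(lra)); lra. }
    specialize (Z Y). lra.
  - pose proof (logistic_incr (x 0%nat 1%nat) (x 0%nat 1%nat + c) ltac:(lra)).
    pose proof (fun P => double_sum_off_eq0 n _ P D 0%nat 1%nat ltac:(lia) ltac:(lia) ltac:(lia)) as Z.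
    cbv beta in Z. assert (Y : forall i k, (i < n)%nat -> (k < n)%nat -> k <> i ->
       0 <= logistic (x i k + c) - logistic (x i k)).
    { intros i k _ _ _. pose proof (logistic_le (x i k) (x i k + c) ltac:(lra)); lra. }
    specialize (Z Y). lra.
Qed.

(** All n in-degree equations are imposed, one more than in [is_MLE]: a half step then treats both
    sides alike, and equality of the totals makes the extra equation consistent. *)
Lemma likelihood_system_solvable n d b a0 b0 delta B :
  (3 <= n)%nat -> 0 <= B -> 0 <= delta -> b0 (n - 1)%nat = 0 ->
  (forall i k, (i < n)%nat -> (k < n)%nat ->
     Rabs (a0 i + b0 k) + 4 * delta / slope_min B + delta <= B) ->
  (forall i, (i < n)%nat -> Rabs (d i - sum_off n i (fun k => logistic (a0 i + b0 k)))
      <= slope_min B * (INR n - 1) * delta) ->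
  (forall j, (j < n)%nat -> Rabs (b j - sum_off n j (fun k => logistic (a0 k + b0 j)))
      <= slope_min B * (INR n - 1) * delta) ->
  sumR n d = sumR n b ->
  exists alpha beta, beta (n - 1)%nat = 0 /\
    (forall i, (i < n)%nat -> d i = sum_off n i (fun k => logistic (alpha i + beta k))) /\
    (forall j, (j < n)%nat -> b j = sum_off n j (fun k => logistic (alpha k + beta j))) /\
    (forall i, (i < n)%nat -> Rabs (alpha i - a0 i) <= 4 * delta / slope_min B + delta) /\
    (forall j, (j < n)%nat -> Rabs (beta j - b0 j) <= 4 * delta / slope_min B).
Proof.
  intros Hn HB Hd Hb0 Hab Hdd Hbb Hsum.
  destruct (slope_min_01 B HB) as [m0 m1]. set (m := slope_min B) in *.
  set (rho := 4 * delta / m) in *.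
  assert (Hrho : 0 <= rho) by (apply Rle_mult_inv_pos; lra).
  (* The radius rho is the fixed point of r -> (1 - m/2) r + 2 delta, so both half steps preserve
     the ball. *)
  assert (Erho : (1 - m / 2) * rho + 2 * delta = rho) by (unfold rho; field; lra).
  assert (comm : forall j (x y : nat -> R),
    sum_off n j (fun k => logistic (x k + y j)) = sum_off n j (fun k => logistic (y j + x k))).
  { intros; apply sum_off_ext; intros; f_equal; ring. }
  assert (Hba : forall j k, (j < n)%nat -> (k < n)%nat -> Rabs (b0 j + a0 k) + rho + delta <= B).
  { intros j k Hj Hk. rewrite Rplus_comm with (r1 := b0 j). now apply Hab. }
  assert (Hbb' : forall j, (j < n)%nat -> Rabs (b j - sum_off n j (fun k => logistic (b0 j + a0 k)))
      <= m * (INR n - 1) * delta).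
  { intros j Hj. rewrite <- comm. now apply Hbb. }
  assert (bounded : forall d' x0 y0 x y,
    (forall i k, (i < n)%nat -> (k < n)%nat -> Rabs (x0 i + y0 k) + rho + delta <= B) ->
    half_solution n d' x0 y0 (rho + delta) y x ->
    forall i k, (i < n)%nat -> (k < n)%nat -> Rabs (x i + y k) <= B).
  { intros d' x0 y0 x y H0 H i k Hi Hk.
    pose proof (H0 i k Hi Hk) as T0. pose proof (proj2 (H i Hi) k Hk) as T1.
    pose proof (Rabs_triang (x i + y k - (x0 i + y0 k)) (x0 i + y0 k)) as T2.
    replace (x i + y k - (x0 i + y0 k) + (x0 i + y0 k)) with (x i + y k) in T2 by ring. lra. }
  assert (near : forall d' x0 y0 x y,
    (forall i k, (i < n)%nat -> (k < n)%nat -> Rabs (x0 i + y0 k) + rho + delta <= B) ->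
    (forall i, (i < n)%nat -> Rabs (d' i - sum_off n i (fun k => logistic (x0 i + y0 k)))
      <= m * (INR n - 1) * delta) ->
    half_solution n d' x0 y0 (rho + delta) y x ->
    osc_le n (fun k => y k - y0 k) rho -> osc_le n (fun k => x k - x0 k) rho).
  { intros d' x0 y0 x y H0 Hd' H Ho. rewrite <- Erho.
    apply half_step_osc with (b := y) (b' := y0); auto.
    - now apply (bounded d' x0 y0).
    - intros i k Hi Hk. specialize (H0 i k Hi Hk). lra.
    - intros i Hi. rewrite (proj1 (H i Hi)). now apply Hd'. }
  assert (contract : forall d' x0 y0 x y x' y' r,
    (forall i k, (i < n)%nat -> (k < n)%nat -> Rabs (x0 i + y0 k) + rho + delta <= B) ->
    half_solution n d' x0 y0 (rho + delta) y x ->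
    half_solution n d' x0 y0 (rho + delta) y' x' ->
    osc_le n (fun k => y k - y' k) r -> osc_le n (fun k => x k - x' k) ((1 - m / 2) * r)).
  { intros d' x0 y0 x y x' y' r H0 H H' Ho.
    replace ((1 - m / 2) * r) with ((1 - m / 2) * r + 2 * 0) by ring.
    apply half_step_osc with (b := y) (b' := y'); auto.
    - lra.
    - now apply (bounded d' x0 y0).
    - now apply (bounded d' x0 y0).
    - intros i Hi. rewrite (proj1 (H i Hi)), (proj1 (H' i Hi)), Rminus_diag, Rabs_R0. lra. }
  (* A relation, turned into a map by choice, because half solutions are only known to exist inside
     the ball. Subtracting z (n-1) restores the normalization and leaves oscillations unchanged. *)
  set (Step := fun y y' : nat -> R => exists x z,
    half_solution n d a0 b0 (rho + delta) y x /\ osc_le n (fun k => x k - a0 k) rho /\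
    half_solution n b b0 a0 (rho + delta) x z /\ osc_le n (fun k => z k - b0 k) rho /\
    forall j, y' j = z j - z (n - 1)%nat).
  set (S := fun y => epsilon (inhabits (fun _ : nat => 0)) (Step y)).
  assert (HS : forall y, osc_le n (fun k => y k - b0 k) rho -> Step y (S y)).
  { intros y Hy. apply epsilon_spec.
    destruct (half_solution_exists n d a0 b0 y rho delta B) as [x Hx]; auto; [lia|].
    pose proof (near d a0 b0 x y Hab Hdd Hx Hy) as Ox.
    destruct (half_solution_exists n b b0 a0 x rho delta B) as [z Hz]; auto; [lia|].
    pose proof (near b b0 a0 z x Hba Hbb' Hz Ox) as Oz.
    exists (fun j => z j - z (n - 1)%nat), x, z. auto. }
  destruct (osc_contraction_fixed_point n S b0 ((1 - m / 2) * (1 - m / 2)) rho)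
    as [y [Zy [Oy Fy]]]; auto; [lia|nra| | | |].
  - intros y Hy. destruct (HS y Hy) as (x & z & _ & _ & _ & _ & E). rewrite E; ring.
  - intros y Hy. destruct (HS y Hy) as (x & z & _ & _ & _ & O & E).
    intros i j Hi Hj. rewrite !E. specialize (O i j Hi Hj). simpl in O. lra.
  - intros y y' r Hy Hy' Ho.
    destruct (HS y Hy) as (x & z & Hx & _ & Hz & _ & E).
    destruct (HS y' Hy') as (x' & z' & Hx' & _ & Hz' & _ & E').
    pose proof (contract d a0 b0 x y x' y' r Hab Hx Hx' Ho) as O1.
    pose proof (contract b b0 a0 z x z' x' _ Hba Hz Hz' O1) as O2.
    intros i j Hi Hj. rewrite !E, !E'. specialize (O2 i j Hi Hj). simpl in O2. lra.
  - destruct (HS y Oy) as (x & z & Hx & Ox & Hz & Oz & E).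
    assert (Ez : forall j, (j < n)%nat -> z j = y j + z (n - 1)%nat).
    { intros j Hj. rewrite <- (Fy j Hj), E. ring. }
    (* At the fixed point z = y + c with c = z (n-1). The sums with z total [sumR n b], those with y
       total [sumR n d]; these agree, so c = 0. *)
    assert (c0 : z (n - 1)%nat = 0).
    { apply (logistic_shift_eq0 n (fun j k => y j + x k)); [lia|].
      transitivity (sumR n b).
      - apply sumR_ext; intros j Hj. rewrite <- (proj1 (Hz j Hj)).
        apply sum_off_ext; intros k _ _. rewrite (Ez j Hj). f_equal; ring.
      - rewrite <- Hsum, <- (sum_off_swap n (fun i j => logistic (y j + x i))).
        apply sumR_ext; intros i Hi. rewrite <- (proj1 (Hx i Hi)).
        apply sum_off_ext; intros k _ _. f_equal; ring. }
    assert (Dy : forall j, (j < n)%nat -> Rabs (y j - b0 j) <= rho).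
    { intros j Hj. pose proof (Oy j (n - 1)%nat Hj ltac:(lia)) as U.
      pose proof (Oy (n - 1)%nat j ltac:(lia) Hj) as V. simpl in U, V.
      rewrite Zy, Hb0 in U, V. apply Rabs_le; lra. }
    exists x, y. split; [exact Zy|]. split; [|split; [|split; [|exact Dy]]].
    + intros i Hi. symmetry. apply Hx, Hi.
    + intros j Hj. rewrite comm, <- (proj1 (Hz j Hj)).
      apply sum_off_ext; intros k _ _. rewrite (Ez j Hj), c0. f_equal; ring.
    (* At k = n-1 both beta sequences vanish, so the bound on sums is a bound on alpha alone. *)
    + intros i Hi. pose proof (proj2 (Hx i Hi) (n - 1)%nat ltac:(lia)) as U.
      rewrite Zy, Hb0, !Rplus_0_r in U. exact U.
Qed.

(** * Uniqueness of the MLE *)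

Lemma betaN_last n beta : betaN n beta (n - 1)%nat = 0.
Proof. unfold betaN. now rewrite Nat.eqb_refl. Qed.

Lemma betaN_lt n beta j : (j < n - 1)%nat -> betaN n beta j = beta j.
Proof. intros H. unfold betaN. destruct (Nat.eqb_spec j (n - 1)); [lia|reflexivity]. Qed.

(** For n = 2 only alpha_0 and alpha_1 + beta_0 enter the equations, so the parameters are not
    identifiable. Uniqueness holds there because a single 0/1 entry never equals a logistic
    value. *)
Lemma no_MLE_2 A a b : ~ is_MLE 2 A a b.
Proof.
  intros [H _]. specialize (H 0%nat ltac:(lia)). unfold outdeg, sum_off in H. simpl in H.
  pose proof (logistic_01 (a 0%nat + betaN 2 b 1)). unfold b2R in H.
  destruct (entry 2 A 0 1); lra.
Qed.

Lemma logistic_monotone_prod x y :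
  0 <= (logistic x - logistic y) * (x - y) /\ ((logistic x - logistic y) * (x - y) = 0 -> x = y).
Proof.
  destruct (Rtotal_order x y) as [H|[->|H]].
  - pose proof (logistic_incr _ _ H). split; nra.
  - split; [right; ring|auto].
  - pose proof (logistic_incr _ _ H). split; nra.
Qed.

(* Pairing the difference of the two likelihood systems with the difference of
   the parameters kills the missing equation, since beta_n is pinned to 0. *)
Lemma MLE_unique n A a1 b1 a2 b2 : (2 <= n)%nat ->
  is_MLE n A a1 b1 -> is_MLE n A a2 b2 ->
  (forall i, (i < n)%nat -> a1 i = a2 i) /\ (forall j, (j < n - 1)%nat -> b1 j = b2 j).
Proof.
  intros Hn H1 H2.
  destruct (Nat.eq_dec n 2) as [->|Hn2]; [now apply no_MLE_2 in H1|].
  destruct H1 as [R1 C1], H2 as [R2 C2].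
  set (x := fun i k => a1 i + betaN n b1 k). set (y := fun i k => a2 i + betaN n b2 k).
  set (g := fun i k => logistic (x i k) - logistic (y i k)).
  set (D := fun k => betaN n b1 k - betaN n b2 k).
  assert (E : sumR n (fun i => sum_off n i (fun k => g i k * (x i k - y i k))) = 0).
  { rewrite (sumR_ext n _ (fun i => (a1 i - a2 i) * sum_off n i (fun k => g i k)
                                 + sum_off n i (fun k => g i k * D k))).
    - rewrite sumR_plus, (sum_off_swap n (fun i k => g i k * D k)), <- sumR_plus.
      rewrite <- (Rmult_0_r (INR n)), <- sumR_const.
      apply sumR_ext; intros j Hj. unfold g at 1; rewrite sum_off_minus.
      unfold x, y; rewrite <- R1, <- R2 by exact Hj.
      rewrite (sum_off_ext n j _ (fun i => D j * g i j)) by (intros; ring).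
      rewrite sum_off_scal. destruct (Nat.eq_dec j (n - 1)) as [->|Hne].
      + unfold D; rewrite !betaN_last; ring.
      + unfold g; rewrite sum_off_minus. unfold x, y.
        rewrite <- C1, <- C2 by lia. ring.
    - intros i _. rewrite <- sum_off_scal, <- sum_off_plus.
      apply sum_off_ext; intros k _ _. unfold D, x, y; ring. }
  assert (Q : forall i k, (i < n)%nat -> (k < n)%nat -> k <> i -> x i k = y i k).
  { intros i k Hi Hk Hki. apply (logistic_monotone_prod (x i k) (y i k)).
    apply (double_sum_off_eq0 n _) with (2 := E); auto.
    intros; apply logistic_monotone_prod. }
  assert (P1 : forall i, (i < n - 1)%nat -> a1 i = a2 i).
  { intros i Hi. pose proof (Q i (n - 1)%nat ltac:(lia) ltac:(lia) ltac:(lia)) as U.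
    unfold x, y in U. rewrite !betaN_last in U. lra. }
  assert (P2 : forall j, (j < n - 1)%nat -> b1 j = b2 j).
  (* A row different from both j and n-1, where alpha is already known; it exists because n >= 3. *)
  { intros j Hj. set (i := if Nat.eqb j 0 then 1%nat else 0%nat).
    assert (Hi : (i < n - 1)%nat /\ j <> i) by (unfold i; destruct (Nat.eqb_spec j 0); lia).
    pose proof (Q i j ltac:(lia) ltac:(lia) ltac:(lia)) as U. unfold x, y in U.
    rewrite !betaN_lt, P1 in U by lia. lra. }
  split; [|exact P2]. intros i Hi.
  destruct (Nat.eq_dec i (n - 1)) as [->|Hne]; [|apply P1; lia].
  pose proof (Q (n - 1)%nat 0%nat Hi ltac:(lia) ltac:(lia)) as U. unfold x, y in U.
  rewrite !betaN_lt, P2 in U by lia. lra.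
Qed.

(** * Finite products and the law of the random matrix *)

Lemma prodR_ext n f g : (forall i, (i < n)%nat -> f i = g i) -> prodR n f = prodR n g.
Proof. induction n; simpl; intros H; auto. rewrite IHn, (H n); auto. Qed.

Lemma prodR_mult n f g : prodR n (fun i => f i * g i) = prodR n f * prodR n g.
Proof. induction n; simpl; [ring|]. rewrite IHn; ring. Qed.

Lemma prodR_nonneg n f : (forall i, (i < n)%nat -> 0 <= f i) -> 0 <= prodR n f.
Proof. induction n; simpl; intros H; [lra|]. apply Rmult_le_pos; auto. Qed.

Lemma prodR_le n f g : (forall i, (i < n)%nat -> 0 <= f i <= g i) -> prodR n f <= prodR n g.
Proof.
  induction n; simpl; intros H; [lra|].
  assert (0 <= prodR n f) by (apply prodR_nonneg; intros; apply H; lia).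
  pose proof (H n (Nat.lt_succ_diag_r n)).
  apply Rmult_le_compat; try lra. apply IHn; auto.
Qed.

Lemma prodR_exp n f : prodR n (fun i => exp (f i)) = exp (sumR n f).
Proof. induction n; simpl; [now rewrite exp_0|]. now rewrite IHn, exp_plus. Qed.

Lemma prodR_add n m f : prodR (n + m) f = prodR n f * prodR m (fun i => f (n + i)%nat).
Proof.
  induction m as [|m IH]; simpl; [rewrite Nat.add_0_r; ring|].
  rewrite Nat.add_succ_r; simpl. rewrite IH; ring.
Qed.

Lemma prodR_S_l n f : prodR (S n) f = f 0%nat * prodR n (fun i => f (S i)).
Proof. rewrite (prodR_add 1 n). simpl. ring. Qed.

Lemma prodR_prodR n m f :
  prodR n (fun i => prodR m (fun j => f (i * m + j)%nat)) = prodR (n * m) f.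
Proof.
  induction n as [|n IH]; [reflexivity|].
  rewrite Nat.mul_succ_l, prodR_add, <- IH. reflexivity.
Qed.

(** Convertible to the sum in [prob], so the lemmas below apply to probabilities directly. *)
Definition sumL {T : Type} (l : list T) (g : T -> R) : R := fold_right Rplus 0 (map g l).

Lemma sumL_ext {T} (l : list T) f g : (forall a, f a = g a) -> sumL l f = sumL l g.
Proof. intros H. unfold sumL. f_equal. now apply map_ext. Qed.

Lemma sumL_le {T} (l : list T) f g : (forall a, f a <= g a) -> sumL l f <= sumL l g.
Proof. intros H. induction l; cbn; [lra|]. apply Rplus_le_compat; auto. Qed.

Lemma sumL_plus {T} (l : list T) f g : sumL l (fun a => f a + g a) = sumL l f + sumL l g.
Proof. unfold sumL; induction l; simpl; lra. Qed.

Lemma sumL_scal {T} (l : list T) c f : sumL l (fun a => c * f a) = c * sumL l f.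
Proof. unfold sumL; induction l; simpl; lra. Qed.

Lemma sumL_sumR {T} (l : list T) n f :
  sumL l (fun a => sumR n (fun i => f i a)) = sumR n (fun i => sumL l (f i)).
Proof.
  induction n; simpl; [|now rewrite sumL_plus, IHn].
  unfold sumL; induction l; simpl; lra.
Qed.

(** The distributive law: expanding a product of two-term sums gives one term per boolean list.
    Independence of the entries enters only through it. *)
Lemma sumL_all_bools_prod K (h : nat -> bool -> R) :
  sumL (all_bools K) (fun A => prodR K (fun l => h l (nth l A false)))
    = prodR K (fun l => h l true + h l false).
Proof.
  revert h. induction K as [|K IH]; intros h; [cbn; ring|].
  rewrite prodR_S_l, <- (IH (fun l => h (S l))). simpl all_bools. set (L := all_bools K). clearbody L.
  rewrite <- sumL_scal. induction L as [|A L IHL]; [reflexivity|].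
  unfold sumL in *. cbn [flat_map map fold_right app]. rewrite <- IHL.
  rewrite !prodR_S_l. cbn [nth]. ring.
Qed.

Lemma sumL_matrix_prod n (w : nat -> nat -> bool -> R) :
  sumL (all_bools (n * n)) (fun A => prodR n (fun i => prodR n (fun j => w i j (entry n A i j))))
    = prodR n (fun i => prodR n (fun j => w i j true + w i j false)).
Proof.
  set (h := fun l b => w (l / n)%nat (l mod n)%nat b).
  assert (D : forall i j b, (j < n)%nat -> h (i * n + j)%nat b = w i j b).
  { intros i j b Hj. unfold h.
    rewrite Nat.div_add_l, Nat.div_small, Nat.add_0_r by lia.
    rewrite (Nat.add_comm (i * n)), Nat.Div0.mod_add, Nat.mod_small by lia. reflexivity. }
  transitivity (prodR (n * n) (fun l => h l true + h l false)).
  - rewrite <- sumL_all_bools_prod. apply sumL_ext; intros A.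
    rewrite <- prodR_prodR. apply prodR_ext; intros i _. apply prodR_ext; intros j Hj.
    now rewrite D.
  - rewrite <- prodR_prodR. apply prodR_ext; intros i _. apply prodR_ext; intros j Hj.
    now rewrite !D.
Qed.

Lemma mass_nonneg n a b A : 0 <= mass n a b A.
Proof.
  unfold mass. apply prodR_nonneg; intros i _; apply prodR_nonneg; intros j _.
  pose proof (logistic_01 (a i + betaN n b j)).
  destruct (Nat.eqb i j), (entry n A i j); simpl; lra.
Qed.

(** * Exponential moments and concentration of the degrees *)

(** From e^(-x) >= 1 - x follows e^x (1 - x) <= 1, and (1 + x + 2x^2)(1 - x) = 1 + x^2 (1 - 2x),
    which is at least 1 exactly when x <= 1/2 or x = 0. *)
Lemma exp_le_quadratic x : x <= 1 / 2 -> exp x <= 1 + x + 2 * x ^ 2.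
Proof.
  intros Hx. pose proof (exp_ineq1_le (- x)) as H. rewrite exp_Ropp in H.
  pose proof (exp_pos x) as P.
  assert (H1 : exp x * (1 - x) <= 1).
  { replace 1 with (exp x * / exp x) at 2 by (field; lra). apply Rmult_le_compat_l; lra. }
  assert (H2 : 1 <= (1 + x + 2 * x ^ 2) * (1 - x)).
  { pose proof (pow2_ge_0 x). nra. }
  apply Rmult_le_reg_r with (1 - x); lra.
Qed.

(** Centring cancels the first-order terms of the quadratic bound, leaving 1 + 2 c^2 p (1 - p). *)
Lemma bernoulli_mgf p c : 0 < p < 1 -> Rabs c <= 1 / 2 ->
  p * exp (c * (1 - p)) + (1 - p) * exp (c * (0 - p)) <= exp (2 * c ^ 2).
Proof.
  intros Hp Hc. apply Rabs_le_inv in Hc.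
  pose proof (exp_le_quadratic (c * (1 - p)) ltac:(nra)) as H1.
  pose proof (exp_le_quadratic (c * (0 - p)) ltac:(nra)) as H2.
  pose proof (exp_ineq1_le (2 * c ^ 2)) as H3. pose proof (pow2_ge_0 c) as C0.
  apply Rle_trans with (1 + 2 * c ^ 2); [|exact H3].
  apply Rle_trans with (p * (1 + c * (1 - p) + 2 * (c * (1 - p)) ^ 2)
    + (1 - p) * (1 + c * (0 - p) + 2 * (c * (0 - p)) ^ 2)).
  - apply Rplus_le_compat; apply Rmult_le_compat_l; lra.
  - replace (_ + _) with (1 + 2 * c ^ 2 * (p * (1 - p))) by ring. nra.
Qed.

Definition centred (n : nat) (a b : nat -> R) (A : list bool) (i j : nat) : R :=
  b2R (entry n A i j) - logistic (a i + betaN n b j).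

(** The coefficients vanish on the diagonal because those entries are deterministic, while [centred]
    subtracts a logistic value there too. *)
Lemma linear_statistic_mgf n a b (c : nat -> nat -> R) :
  (forall i j, Rabs (c i j) <= 1 / 2) -> (forall i, c i i = 0) ->
  sumL (all_bools (n * n)) (fun A => mass n a b A *
      exp (sumR n (fun i => sumR n (fun j => c i j * centred n a b A i j))))
    <= exp (2 * sumR n (fun i => sumR n (fun j => c i j ^ 2))).
Proof.
  intros Hc H0.
  set (w := fun i j (x : bool) =>
    (if Nat.eqb i j then (if x then 0 else 1)
     else let p := logistic (a i + betaN n b j) in if x then p else 1 - p)
    * exp (c i j * (b2R x - logistic (a i + betaN n b j)))).
  rewrite (sumL_ext _ _ (fun A => prodR n (fun i => prodR n (fun j => w i j (entry n A i j))))).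
  - rewrite sumL_matrix_prod, <- sumR_scal, <- prodR_exp.
    apply prodR_le; intros i _.
    assert (W : forall j, 0 <= w i j true + w i j false <= exp (2 * c i j ^ 2)).
    { intros j. unfold w. pose proof (logistic_01 (a i + betaN n b j)) as Hp. simpl b2R.
      pose proof (exp_pos (c i j * (1 - logistic (a i + betaN n b j)))).
      pose proof (exp_pos (c i j * (0 - logistic (a i + betaN n b j)))).
      destruct (Nat.eqb_spec i j) as [->|_].
      - rewrite H0. replace (2 * 0 ^ 2) with 0 by ring. rewrite !Rmult_0_l, exp_0. lra.
      - split; [nra|]. now apply bernoulli_mgf. }
    split; [apply prodR_nonneg; intros j _; apply W|].
    rewrite <- sumR_scal, <- prodR_exp. apply prodR_le; intros j _; apply W.
  - intros A. unfold mass. rewrite <- prodR_exp, <- prodR_mult.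
    apply prodR_ext; intros i _. rewrite <- prodR_exp, <- prodR_mult. reflexivity.
Qed.

Lemma total_mass n a b : sumL (all_bools (n * n)) (mass n a b) = 1.
Proof.
  eapply eq_trans; [exact (sumL_matrix_prod n (fun i j x =>
    if Nat.eqb i j then (if x then 0 else 1)
    else let p := logistic (a i + betaN n b j) in if x then p else 1 - p))|].
  rewrite (prodR_ext n _ (fun _ => exp 0)).
  - rewrite prodR_exp, sumR_const, Rmult_0_r. apply exp_0.
  - intros i _. rewrite (prodR_ext n _ (fun _ => exp 0)).
    + now rewrite prodR_exp, sumR_const, Rmult_0_r.
    + intros j _. rewrite exp_0. destruct (Nat.eqb i j); cbv zeta; ring.
Qed.

Lemma prob_mono n a b (E E' : list bool -> Prop) :
  (forall A, E A -> E' A) -> prob n a b E <= prob n a b E'.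
Proof.
  intros H. apply sumL_le; intros A. pose proof (mass_nonneg n a b A).
  destruct (excluded_middle_informative (E A)), (excluded_middle_informative (E' A));
    solve [lra | exfalso; auto].
Qed.

(** Markov's inequality for the complement of [E], whose indicator [g] dominates. *)
Lemma prob_ge_of_majorant n a b (E : list bool -> Prop) (g : list bool -> R) :
  (forall A, 0 <= g A) -> (forall A, ~ E A -> 1 <= g A) ->
  1 - sumL (all_bools (n * n)) (fun A => mass n a b A * g A) <= prob n a b E.
Proof.
  intros H0 H1. rewrite <- (total_mass n a b).
  enough (T : sumL (all_bools (n * n)) (mass n a b)
    <= sumL (all_bools (n * n)) (fun A => (if excluded_middle_informative (E A)
         then mass n a b A else 0) + mass n a b A * g A)).
  { rewrite sumL_plus in T. unfold prob.
    change (fold_right Rplus 0 (map ?f ?l)) with (sumL l f). lra. }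
  apply sumL_le; intros A. pose proof (mass_nonneg n a b A) as M. specialize (H0 A).
  destruct (excluded_middle_informative (E A)) as [|Hn]; [nra|].
  specialize (H1 A Hn). nra.
Qed.

Definition degrees_within (n : nat) (a b : nat -> R) (r : R) (A : list bool) : Prop :=
  (forall i, (i < n)%nat ->
     Rabs (outdeg n A i - sum_off n i (fun k => logistic (a i + betaN n b k))) <= r) /\
  (forall j, (j < n)%nat ->
     Rabs (indeg n A j - sum_off n j (fun k => logistic (a k + betaN n b j))) <= r).

Lemma sumR_sumR_row n i (f : nat -> nat -> R) : (i < n)%nat ->
  sumR n (fun i' => sumR n (fun j => if Nat.eqb i' i then if Nat.eqb j i then 0 else f i' j else 0))
    = sum_off n i (f i).
Proof.
  intros Hi. unfold sum_off.
  rewrite <- (sumR_single n i (fun i' => sumR n (fun k => if Nat.eqb k i then 0 else f i' k)) Hi).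
  apply sumR_ext; intros i' _. destruct (Nat.eqb i' i); [reflexivity|].
  rewrite sumR_const; ring.
Qed.

Lemma sumR_sumR_col n j (f : nat -> nat -> R) : (j < n)%nat ->
  sumR n (fun i => sumR n (fun j' => if Nat.eqb j' j then if Nat.eqb i j then 0 else f i j' else 0))
    = sum_off n j (fun i => f i j).
Proof.
  intros Hj. rewrite sumR_swap. exact (sumR_sumR_row n j (fun j' i => f i j') Hj).
Qed.

Lemma outdeg_mgf n a b i c : (i < n)%nat -> Rabs c <= 1 / 2 ->
  sumL (all_bools (n * n)) (fun A => mass n a b A *
      exp (c * (outdeg n A i - sum_off n i (fun k => logistic (a i + betaN n b k)))))
    <= exp (2 * (INR n * c ^ 2)).
Proof.
  intros Hi Hc.
  pose (C := fun i' j => if Nat.eqb i' i then if Nat.eqb j i then 0 else c else 0).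
  assert (HC : forall i' j, Rabs (C i' j) <= 1 / 2).
  { intros i' j; unfold C; destruct (Nat.eqb i' i), (Nat.eqb j i); rewrite ?Rabs_R0; lra. }
  assert (HC0 : forall i', C i' i' = 0) by (intros i'; unfold C; now destruct (Nat.eqb i' i)).
  pose proof (linear_statistic_mgf n a b C HC HC0) as H.
  rewrite (sumL_ext _ _ (fun A => mass n a b A * exp (sumR n (fun i' => sumR n
    (fun j => C i' j * centred n a b A i' j))))).
  - apply Rle_trans with (1 := H). apply exp_le, Rmult_le_compat_l; [lra|].
    rewrite (sumR_ext n _ (fun i' => sumR n (fun j => if Nat.eqb i' i then
      if Nat.eqb j i then 0 else (fun _ _ => c ^ 2) i' j else 0))).
    + rewrite (sumR_sumR_row n i (fun _ _ => c ^ 2)), sum_off_const by exact Hi.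
      pose proof (pow2_ge_0 c). nra.
    + intros i' _; apply sumR_ext; intros j _; unfold C.
      destruct (Nat.eqb i' i), (Nat.eqb j i); ring.
  - intros A. do 2 f_equal. unfold outdeg. rewrite <- sum_off_minus, <- sum_off_scal.
    eapply eq_trans;
      [exact (eq_sym (sumR_sumR_row n i (fun i' k => c * centred n a b A i' k) Hi))|].
    apply sumR_ext; intros i' _; apply sumR_ext; intros j _; unfold C.
    destruct (Nat.eqb i' i), (Nat.eqb j i); ring.
Qed.

Lemma indeg_mgf n a b j c : (j < n)%nat -> Rabs c <= 1 / 2 ->
  sumL (all_bools (n * n)) (fun A => mass n a b A *
      exp (c * (indeg n A j - sum_off n j (fun k => logistic (a k + betaN n b j)))))
    <= exp (2 * (INR n * c ^ 2)).
Proof.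
  intros Hj Hc.
  pose (C := fun i j' => if Nat.eqb j' j then if Nat.eqb i j then 0 else c else 0).
  assert (HC : forall i j', Rabs (C i j') <= 1 / 2).
  { intros i j'; unfold C; destruct (Nat.eqb j' j), (Nat.eqb i j); rewrite ?Rabs_R0; lra. }
  assert (HC0 : forall i, C i i = 0) by (intros i; unfold C; now destruct (Nat.eqb i j)).
  pose proof (linear_statistic_mgf n a b C HC HC0) as H.
  rewrite (sumL_ext _ _ (fun A => mass n a b A * exp (sumR n (fun i => sumR n
    (fun j' => C i j' * centred n a b A i j'))))).
  - apply Rle_trans with (1 := H). apply exp_le, Rmult_le_compat_l; [lra|].
    rewrite (sumR_ext n _ (fun i => sumR n (fun j' => if Nat.eqb j' j then
      if Nat.eqb i j then 0 else (fun _ _ => c ^ 2) i j' else 0))).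
    + rewrite (sumR_sumR_col n j (fun _ _ => c ^ 2)), sum_off_const by exact Hj.
      pose proof (pow2_ge_0 c). nra.
    + intros i _; apply sumR_ext; intros j' _; unfold C.
      destruct (Nat.eqb j' j), (Nat.eqb i j); ring.
  - intros A. do 2 f_equal. unfold indeg. rewrite <- sum_off_minus, <- sum_off_scal.
    eapply eq_trans;
      [exact (eq_sym (sumR_sumR_col n j (fun k j' => c * centred n a b A k j') Hj))|].
    apply sumR_ext; intros i _; apply sumR_ext; intros j' _; unfold C.
    destruct (Nat.eqb j' j), (Nat.eqb i j); ring.
Qed.

Lemma degree_concentration n a b lam r : 0 <= lam <= 1 / 2 ->
  1 - 4 * INR n * exp (2 * (INR n * lam ^ 2) - lam * r) <= prob n a b (degrees_within n a b r).
Proof.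
  intros Hl.
  set (dO := fun i A => outdeg n A i - sum_off n i (fun k => logistic (a i + betaN n b k))).
  set (dI := fun j A => indeg n A j - sum_off n j (fun k => logistic (a k + betaN n b j))).
  set (e := fun c x => exp (c * x) * exp (- (lam * r))).
  (* The four Chernoff exponentials of index i. All are positive, so a sum over i below 1 keeps each
     of them below 1; this majorant replaces a union bound over the 2n degrees and two signs. *)
  set (G := fun i A => e lam (dO i A) + e (- lam) (dO i A) + e lam (dI i A) + e (- lam) (dI i A)).
  assert (e0 : forall c x, 0 < e c x) by (intros; apply Rmult_lt_0_compat; apply exp_pos).
  assert (e1 : forall x, r < Rabs x -> 1 <= e lam x + e (- lam) x).
  { intros x Hx. pose proof (e0 lam x). pose proof (e0 (- lam) x).
    unfold Rabs in Hx; destruct (Rcase_abs x).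
    - apply Rle_trans with (e (- lam) x); [|lra]. unfold e. rewrite <- exp_plus, <- exp_0.
      apply exp_le. nra.
    - apply Rle_trans with (e lam x); [|lra]. unfold e. rewrite <- exp_plus, <- exp_0.
      apply exp_le. nra. }
  assert (G0 : forall i A, 0 <= G i A).
  { intros i A. unfold G. pose proof (e0 lam (dO i A)). pose proof (e0 (- lam) (dO i A)).
    pose proof (e0 lam (dI i A)). pose proof (e0 (- lam) (dI i A)). lra. }
  eapply Rle_trans; [|apply (prob_ge_of_majorant n a b _ (fun A => sumR n (fun i => G i A)))].
  - apply Rplus_le_compat_l, Ropp_le_contravar.
    rewrite (sumL_ext _ _ (fun A => sumR n (fun i => mass n a b A * G i A)))
      by (intros; now rewrite sumR_scal).
    rewrite sumL_sumR, (Rmult_comm 4), Rmult_assoc, <- sumR_const. apply sumR_le; intros i Hi.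
    rewrite (sumL_ext _ _ (fun A => exp (- (lam * r)) * (mass n a b A * exp (lam * dO i A)
      + mass n a b A * exp (- lam * dO i A) + mass n a b A * exp (lam * dI i A)
      + mass n a b A * exp (- lam * dI i A)))) by (intros; unfold G, e; ring).
    rewrite sumL_scal, !sumL_plus. unfold Rminus. rewrite exp_plus.
    pose proof (outdeg_mgf n a b i lam Hi ltac:(apply Rabs_le; lra)) as M1.
    pose proof (outdeg_mgf n a b i (- lam) Hi ltac:(apply Rabs_le; lra)) as M2.
    pose proof (indeg_mgf n a b i lam Hi ltac:(apply Rabs_le; lra)) as M3.
    pose proof (indeg_mgf n a b i (- lam) Hi ltac:(apply Rabs_le; lra)) as M4.
    replace ((- lam) ^ 2) with (lam ^ 2) in * by ring.
    fold (dO i) in M1, M2. unfold dO, dI. pose proof (exp_pos (- (lam * r))). nra.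
  - intros A. apply sumR_nonneg; auto.
  - intros A HA. apply Rnot_lt_le; intros Hlt. apply HA.
    assert (S : forall i, (i < n)%nat -> G i A < 1).
    { intros i Hi. apply Rle_lt_trans with (2 := Hlt).
      rewrite <- (sumR_single n i (fun i => G i A) Hi). apply sumR_le; intros k _.
      destruct (Nat.eqb k i); [lra|apply G0]. }
    split; intros i Hi; apply Rnot_lt_le; intros Hr; specialize (S i Hi); unfold G in S;
      pose proof (e0 lam (dO i A)); pose proof (e0 (- lam) (dO i A));
      pose proof (e0 lam (dI i A)); pose proof (e0 (- lam) (dI i A)).
    + pose proof (e1 (dO i A) Hr). lra.
    + pose proof (e1 (dI i A) Hr). lra.
Qed.

(** * The sup norm and the size of the rate *)

Lemma maxR_nonneg n f : 0 <= maxR n f.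
Proof.
  unfold maxR. induction (map f (seq 0 n)); simpl; [lra|].
  eapply Rle_trans; [exact IHl|apply Rmax_r].
Qed.

Lemma maxR_ge n f i : (i < n)%nat -> f i <= maxR n f.
Proof.
  intros Hi. assert (H : In (f i) (map f (seq 0 n))) by (apply in_map, in_seq; lia).
  unfold maxR. induction (map f (seq 0 n)) as [|x l IH]; simpl in *; [contradiction|].
  destruct H as [->|H]; [apply Rmax_l|]. eapply Rle_trans; [apply IH, H|apply Rmax_r].
Qed.

Lemma maxR_le n f c : 0 <= c -> (forall i, (i < n)%nat -> f i <= c) -> maxR n f <= c.
Proof.
  intros Hc H. unfold maxR.
  assert (G : forall x, In x (map f (seq 0 n)) -> x <= c).
  { intros x Hx. apply in_map_iff in Hx. destruct Hx as [i [<- Hi]].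
    apply in_seq in Hi. apply H; lia. }
  induction (map f (seq 0 n)) as [|x l IH]; simpl in *; [lra|].
  apply Rmax_lub; auto.
Qed.

Lemma supnorm_nonneg n a b : 0 <= supnorm n a b.
Proof. unfold supnorm. eapply Rle_trans; [apply maxR_nonneg|apply Rmax_l]. Qed.

Lemma supnorm_alpha n a b i : (i < n)%nat -> Rabs (a i) <= supnorm n a b.
Proof.
  intros Hi. eapply Rle_trans; [apply (maxR_ge n (fun i => Rabs (a i)) i Hi)|apply Rmax_l].
Qed.

Lemma supnorm_betaN n a b j : (j < n)%nat -> Rabs (betaN n b j) <= supnorm n a b.
Proof.
  intros Hj. unfold betaN. destruct (Nat.eqb_spec j (n - 1)).
  - rewrite Rabs_R0. apply supnorm_nonneg.
  - eapply Rle_trans; [apply (maxR_ge (n - 1) (fun j => Rabs (b j)) j); lia|apply Rmax_r].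
Qed.

Lemma betaN_id n b j : b (n - 1)%nat = 0 -> betaN n b j = b j.
Proof. intros H. unfold betaN. destruct (Nat.eqb_spec j (n - 1)) as [->|]; auto. Qed.

Lemma ln_le x y : 0 < x -> x <= y -> ln x <= ln y.
Proof. intros Hx [H| ->]; [left; now apply ln_increasing|lra]. Qed.

Lemma ln_INR_large K : exists N, forall n, (N <= n)%nat -> K <= ln (INR n).
Proof.
  destruct (INR_unbounded (exp K)) as [N HN]. exists N. intros n Hn. apply le_INR in Hn.
  rewrite <- (ln_exp K). apply ln_le; [apply exp_pos|lra].
Qed.

(** With L = log n, tau < 1/24 gives exp(8s) <= exp(L/3), so the rate is at most sqrt(L) exp(-L/6).
    Squaring exp(L/12) >= L/12 bounds L exp(-L/6) by 144 / L. The summand 1 in the threshold ensures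
    sqrt(L) <= L. *)
Lemma rate_small tau delta : tau < 1 / 24 -> 0 < delta ->
  exists N, forall n s, (N <= n)%nat -> s <= tau * ln (INR n) -> rate n s <= delta.
Proof.
  intros Ht Hd. destruct (ln_INR_large (1 + 144 / delta)) as [N HN].
  exists (N + 1)%nat. intros n s Hn Hs. specialize (HN n ltac:(lia)).
  assert (Hn0 : 0 < INR n) by (apply lt_0_INR; lia).
  assert (Hd0 : 0 < 144 / delta) by (apply Rdiv_lt_0_compat; lra).
  set (L := ln (INR n)) in *.
  assert (E : sqrt (INR n) = exp (L / 2)).
  { apply sqrt_lem_1; [lra|left; apply exp_pos|]. rewrite <- exp_plus.
    replace (L / 2 + L / 2) with L by field. apply exp_ln, Hn0. }
  unfold rate. rewrite E. fold L. unfold Rdiv at 1. rewrite <- exp_Ropp, Rmult_assoc, <- exp_plus.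
  assert (S : sqrt L <= L).
  { rewrite <- (sqrt_square L) at 2 by lra. apply sqrt_le_1_alt. nra. }
  assert (X : exp (8 * s + - (L / 2)) <= exp (- (L / 6))) by (apply exp_le; nra).
  apply Rle_trans with (L * exp (- (L / 6))).
  { apply Rmult_le_compat; auto; [apply sqrt_pos|left; apply exp_pos]. }
  rewrite exp_Ropp. replace (L / 6) with (L / 12 + L / 12) by field. rewrite exp_plus.
  pose proof (exp_ineq1_le (L / 12)) as G.
  assert (W : / (exp (L / 12) * exp (L / 12)) <= / (L / 12 * (L / 12))).
  { apply Rinv_le_contravar; nra. }
  apply Rle_trans with (L * / (L / 12 * (L / 12))); [apply Rmult_le_compat_l; lra|].
  replace (L * / (L / 12 * (L / 12))) with (144 / L) by (field; lra).
  apply Rmult_le_reg_r with L; [lra|]. unfold Rdiv. rewrite Rmult_assoc, Rinv_l by lra.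
  replace (144 * 1) with (delta * (144 / delta)) by (field; lra).
  apply Rmult_le_compat_l; lra.
Qed.

(** * From concentrated degrees to the asymptotic statements *)

(** 640 = 5 * 4 * 16 * 2: the 5 from 4 delta / m + delta <= 5 delta / m, the 4 from the degree
    deviation, 16 exp 4 from slope_min(2s+1)^(-2), the 2 from n / (n-1) <= 2. *)
Definition rate_const : R := 640 * exp 4.

Lemma MLE_near_of_degrees_within n a b A : (3 <= n)%nat ->
  rate_const * rate n (supnorm n a b) <= 1 ->
  degrees_within n a b (4 * (sqrt (INR n) * sqrt (ln (INR n)))) A ->
  exists ah bh, is_MLE n A ah bh /\
    supnorm n (fun i => ah i - a i) (fun j => bh j - b j) <= rate_const * rate n (supnorm n a b).
Proof.
  intros Hn Hrate [HO HI]. set (s := supnorm n a b) in *.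
  assert (s0 : 0 <= s) by apply supnorm_nonneg.
  set (B := 2 * s + 1). assert (HB : 0 <= B) by (unfold B; lra).
  destruct (slope_min_01 B HB) as [m0 m1].
  set (r := 4 * (sqrt (INR n) * sqrt (ln (INR n)))) in *.
  assert (HN : 3 <= INR n). { apply le_INR in Hn. simpl in Hn. lra. }
  assert (q0 : 0 < sqrt (INR n)) by (apply sqrt_lt_R0; lra).
  assert (r0 : 0 <= r).
  { unfold r. pose proof (sqrt_pos (ln (INR n))). nra. }
  set (delta := r / (slope_min B * (INR n - 1))).
  assert (P : 0 < slope_min B * (INR n - 1)) by nra.
  assert (d0 : 0 <= delta) by now apply Rle_mult_inv_pos.
  assert (Er : slope_min B * (INR n - 1) * delta = r) by (unfold delta; field; lra).
  assert (K : 4 * delta / slope_min B + delta <= rate_const * rate n s).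
  { apply Rle_trans with (5 * (delta / slope_min B)).
    { assert (delta <= delta / slope_min B).
      { apply Rmult_le_reg_r with (1 := m0). unfold Rdiv. rewrite Rmult_assoc, Rinv_l by lra. nra. }
      unfold Rdiv in *. lra. }
    assert (Em : slope_min B * slope_min B = / (16 * exp (8 * s + 4))).
    { unfold slope_min, B. rewrite Rinv_mult, <- exp_Ropp.
      replace (- (8 * s + 4)) with (- (2 * (2 * s + 1)) + - (2 * (2 * s + 1))) by ring.
      rewrite exp_plus. field. }
    replace (delta / slope_min B) with (r * / (slope_min B * slope_min B) / (INR n - 1))
      by (unfold delta; field; lra).
    rewrite Em, Rinv_inv.
    replace (rate_const * rate n s) with (5 * (r * (16 * exp (8 * s + 4)) * (2 / INR n))).
    - apply Rmult_le_compat_l; [lra|]. unfold Rdiv at 1. apply Rmult_le_compat_l.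
      + pose proof (exp_pos (8 * s + 4)). apply Rmult_le_pos; lra.
      + apply Rmult_le_reg_r with ((INR n - 1) * INR n); [nra|].
        replace (/ (INR n - 1) * ((INR n - 1) * INR n)) with (INR n) by (field; lra).
        replace (2 / INR n * ((INR n - 1) * INR n)) with (2 * (INR n - 1)) by (field; lra). lra.
    - unfold rate_const, rate, r. rewrite exp_plus.
      replace (INR n) with (sqrt (INR n) * sqrt (INR n)) at 3 by (apply sqrt_sqrt; lra).
      field. lra. }
  destruct (likelihood_system_solvable n (outdeg n A) (indeg n A) a (betaN n b) delta B)
    as (x & y & Zy & Hx & Hy & Dx & Dy); auto.
  - apply betaN_last.
  - intros i k Hi Hk. pose proof (supnorm_alpha n a b i Hi) as U.
    pose proof (supnorm_betaN n a b k Hk) as V. fold s in U, V.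
    pose proof (Rabs_triang (a i) (betaN n b k)).
    assert (B = 2 * s + 1) by reflexivity. lra.
  - intros i Hi. rewrite Er. now apply HO.
  - intros j Hj. rewrite Er. now apply HI.
  - unfold outdeg, indeg. apply sum_off_swap.
  - exists x, y. split.
    + split; intros i Hi; [rewrite Hx by lia|rewrite Hy by lia];
        apply sum_off_ext; intros k _ _; now rewrite betaN_id.
    + assert (c0 : 0 <= rate_const * rate n s).
      { apply Rle_trans with (2 := K). pose proof (Rle_mult_inv_pos (4 * delta) _ ltac:(lra) m0).
        unfold Rdiv; lra. }
      apply Rmax_lub; apply maxR_le; auto; intros i Hi.
      * eapply Rle_trans; [apply Dx, Hi|exact K].
      * rewrite <- (betaN_lt n b i Hi).
        eapply Rle_trans; [apply Dy; lia|]. lra.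
Qed.

Lemma degrees_within_whp n a b s eps : (3 <= n)%nat -> 0 <= s -> rate n s <= 1 / 2 ->
  4 / INR n <= eps ->
  prob n a b (degrees_within n a b (4 * (sqrt (INR n) * sqrt (ln (INR n))))) >= 1 - eps.
Proof.
  intros Hn Hs Hr He.
  assert (HN : 3 <= INR n). { apply le_INR in Hn. simpl in Hn. lra. }
  assert (q0 : 0 < sqrt (INR n)) by (apply sqrt_lt_R0; lra).
  (* The minimizer r / (4n) of 2 n lam^2 - lam r at r = 4 sqrt(n log n); the minimum is -2 log n.
     The rate is lam exp(8s), so its bound 1/2 passes to lam. *)
  set (lam := sqrt (ln (INR n)) / sqrt (INR n)).
  assert (l0 : 0 <= lam) by (apply Rle_mult_inv_pos; [apply sqrt_pos|lra]).
  assert (L0 : 0 <= ln (INR n)) by (rewrite <- ln_1; apply ln_le; lra).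
  assert (l1 : lam <= 1 / 2).
  { apply Rle_trans with (2 := Hr). unfold rate.
    replace (_ / _) with (lam * exp (8 * s)) by (unfold lam; field; lra).
    pose proof (exp_le 0 (8 * s) ltac:(lra)) as X. rewrite exp_0 in X. nra. }
  assert (Q1 : sqrt (INR n) * sqrt (INR n) = INR n) by (apply sqrt_sqrt; lra).
  assert (Q2 : sqrt (ln (INR n)) * sqrt (ln (INR n)) = ln (INR n)) by (apply sqrt_sqrt; lra).
  apply Rle_ge. eapply Rle_trans; [|apply (degree_concentration n a b lam); lra].
  assert (E1 : INR n * lam ^ 2 = ln (INR n)).
  { rewrite <- Q1, <- Q2 at 1. rewrite Q1. unfold lam. rewrite <- Q1 at 1. field. lra. }
  assert (E2 : lam * (4 * (sqrt (INR n) * sqrt (ln (INR n)))) = 4 * ln (INR n)).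
  { rewrite <- Q2 at 2. unfold lam. field. lra. }
  rewrite E1, E2.
  replace (2 * ln (INR n) - 4 * ln (INR n)) with (- (ln (INR n) + ln (INR n))) by ring.
  rewrite exp_Ropp, exp_plus, exp_ln by lra.
  replace (4 * INR n * / (INR n * INR n)) with (4 / INR n) by (field; lra). lra.
Qed.

(** Existence, the O_p bound and the o_p(1) bound all follow from this one event, since [prob] is
    monotone and [rate_const] does not depend on eps. *)
Lemma MLE_near_whp tau (a b : nat -> nat -> R) eps delta : tau < 1 / 24 ->
  (forall n, (2 <= n)%nat -> supnorm n (a n) (b n) <= tau * ln (INR n)) ->
  0 < eps -> 0 < delta -> exists N, forall n, (N <= n)%nat ->
  prob n (a n) (b n) (fun A => exists ah bh, is_MLE n A ah bh /\
    supnorm n (fun i => ah i - a n i) (fun j => bh j - b n j)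
      <= rate_const * rate n (supnorm n (a n) (b n))) >= 1 - eps
  /\ rate_const * rate n (supnorm n (a n) (b n)) <= delta.
Proof.
  intros Ht H He Hd.
  assert (c0 : 1 <= rate_const).
  { unfold rate_const. pose proof (exp_ineq1_le 4). lra. }
  (* The 1/2 serves twice: it keeps the error within the room 1, and, as [rate_const] is at least 1,
     it bounds the rate itself as the Chernoff parameter requires. *)
  destruct (rate_small tau (Rmin (1 / 2) delta / rate_const) Ht) as [N1 H1].
  { apply Rdiv_lt_0_compat; [apply Rmin_pos|]; lra. }
  destruct (INR_unbounded (4 / eps)) as [N2 H2].
  exists (N1 + N2 + 3)%nat. intros n Hn.
  specialize (H n ltac:(lia)). specialize (H1 n _ ltac:(lia) H).
  assert (HN : INR N2 <= INR n) by (apply le_INR; lia).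
  assert (HN3 : 3 <= INR n). { replace 3 with (INR 3) by (simpl; lra). apply le_INR; lia. }
  set (s := supnorm n (a n) (b n)) in *.
  assert (R1 : rate_const * rate n s <= Rmin (1 / 2) delta).
  { replace (Rmin (1 / 2) delta) with (rate_const * (Rmin (1 / 2) delta / rate_const))
      by (field; lra).
    apply Rmult_le_compat_l; lra. }
  pose proof (Rmin_l (1 / 2) delta). pose proof (Rmin_r (1 / 2) delta).
  assert (r0 : 0 <= rate n s).
  { unfold rate. apply Rle_mult_inv_pos; [|apply sqrt_lt_R0; lra].
    apply Rmult_le_pos; [apply sqrt_pos|left; apply exp_pos]. }
  split; [|lra].
  eapply Rge_trans; [|apply (degrees_within_whp n (a n) (b n) s eps)].
  - apply Rle_ge, prob_mono. intros A HA. apply MLE_near_of_degrees_within; auto; [lia|].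
    fold s. lra.
  - lia.
  - apply supnorm_nonneg.
  - nra.
  - apply Rmult_le_reg_r with (INR n); [lra|]. unfold Rdiv. rewrite Rmult_assoc, Rinv_l by lra.
    apply Rle_trans with (eps * (4 / eps)); [right; field; lra|]. apply Rmult_le_compat_l; lra.
Qed.

Theorem theorem1 :
  forall (tau : R), 0 < tau -> tau < 1 / 24 ->
  forall (alpha_s beta_s : nat -> nat -> R),
  (forall n, (2 <= n)%nat -> supnorm n (alpha_s n) (beta_s n) <= tau * ln (INR n)) ->
  (* the MLE exists with probability tending to one *)
  (forall eps, 0 < eps -> exists N, forall n, (N <= n)%nat ->
     prob n (alpha_s n) (beta_s n) (fun A => MLE_exists n A) >= 1 - eps) /\
  (* ||hat theta - theta*||_inf = O_p( rate ) *)
  (forall eps, 0 < eps -> exists C, 0 < C /\ exists N, forall n, (N <= n)%nat ->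
     prob n (alpha_s n) (beta_s n)
       (fun A => exists ah bh, is_MLE n A ah bh /\
          supnorm n (fun i => ah i - alpha_s n i) (fun j => bh j - beta_s n j)
            <= C * rate n (supnorm n (alpha_s n) (beta_s n))) >= 1 - eps) /\
  (* ||hat theta - theta*||_inf = o_p(1) *)
  (forall eps delta, 0 < eps -> 0 < delta -> exists N, forall n, (N <= n)%nat ->
     prob n (alpha_s n) (beta_s n)
       (fun A => exists ah bh, is_MLE n A ah bh /\
          supnorm n (fun i => ah i - alpha_s n i) (fun j => bh j - beta_s n j)
            <= delta) >= 1 - eps) /\
  (* whenever the MLE exists it is unique *)
  (forall n (A : list bool) a1 b1 a2 b2, (2 <= n)%nat ->
     is_MLE n A a1 b1 -> is_MLE n A a2 b2 ->
     (forall i, (i < n)%nat -> a1 i = a2 i) /\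
     (forall j, (j < n - 1)%nat -> b1 j = b2 j)).
Proof.
  intros tau _ Ht a b H. split; [|split; [|split]].
  - intros eps He. destruct (MLE_near_whp tau a b eps 1 Ht H He Rlt_0_1) as [N HN].
    exists N. intros n Hn. eapply Rge_trans; [|apply (HN n Hn)].
    apply Rle_ge, prob_mono. intros A (ah & bh & HM & _). now exists ah, bh.
  - intros eps He. exists rate_const. split.
    + unfold rate_const. pose proof (exp_pos 4). lra.
    + destruct (MLE_near_whp tau a b eps 1 Ht H He Rlt_0_1) as [N HN].
      exists N. intros n Hn. apply (HN n Hn).
  - intros eps delta He Hd. destruct (MLE_near_whp tau a b eps delta Ht H He Hd) as [N HN].
    exists N. intros n Hn. destruct (HN n Hn) as [HP Hr]. eapply Rge_trans; [|exact HP].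
    apply Rle_ge, prob_mono. intros A (ah & bh & HM & Hs). exists ah, bh. split; [exact HM|lra].
  - intros n A a1 b1 a2 b2. apply MLE_unique.
Qed.
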